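(* Let $k \ge 2$ be even and let $n \ge 1$. Every $k$-minimal $n$-vertex tree has exactly $f_k(n)$ $k$-MDISs. Furthermore, the following hold (trees being considered up to isomorphism): (i) If $n \le k+1$, then all $n$-vertex trees are $k$-minimal; if $n = k+2$, then the path $P_{k+2}$ is the only $k$-minimal $n$-vertex tree. (ii) If $k+3 \le n \le 3k/2+2$, then $\mathrm{Add}^*_k(P_{k+2}, n-k-2) \cup \mathrm{Add}_k(P_{k+3}, n-k-3)$ is the class of all $k$-minimal $n$-vertex trees. (iii) If $n \ge 3k/2+3$, then $\mathrm{Add}_k(S'_{p,k/2+1}, r)$ is the class of all $k$-minimal $n$-vertex trees, where $p = \lfloor n/(k/2+1) \rfloor$ and $r = n \bmod (k/2+1)$.
   Context: Graphs are finite and simple. A set $J \subseteq V(G)$ is a distance-$k$ independent set if any two distinct vertices of $J$ are at distance at least $k+1$; a $k$-MDIS is an inclusion-wise maximal distance-$k$ independent set. An $n$-vertex tree is $k$-minimal if it has the minimum possible number of $k$-MDISs among all $n$-vertex trees. The function $f_k$: $f_k(n) = n$ if $n \le k+1$, and $f_k(n) = n - \left\lfloor \frac{n - (k \bmod 2)}{\lfloor k/2 \rfloor + 1} \right\rfloor + 1$ if $n \ge k+2$. $P_m$ is the path on $m$ vertices. $S_{p,m}$ is the $(pm+1)$-vertex tree obtained from $p$ disjoint copies of $P_m$ by adding a new vertex and joining it to one endvertex of each copy; $S'_{p,m}$ is the $(pm)$-vertex subtree of $S_{p,m}$ obtained by removing an arbitrary leaf. $N_k[v]$ is the set of vertices at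 distance at most $k$ from $v$. A vertex $u$ of a tree $T$ is a $k$-twin if there is $v \in V(T)\setminus\{u\}$ with $N_k[u]=N_k[v]$. A leaf is a vertex of degree 1; a diametral leaf is a leaf of maximum eccentricity among all leaves. A diametral $k$-twin is a diametral leaf that is a $k$-twin. A pair $(x,y)$ of vertices is $k$-special if $x$ and $y$ are diametral leaves that are both $k$-twins but $N_k[x] \ne N_k[y]$. For an $m$-vertex tree $T$ with no diametral $k$-twins and $r \ge 0$: $\mathrm{Add}_k(T,r)$ is the family of all $(m+r)$-vertex trees of diameter $\mathrm{diam}(T)$ that contain $T$ as a subgraph and do not contain diametral $k$-twins; $\mathrm{Add}^*_k(T,r)$ is the family of all $(m+r)$-vertex trees of diameter $\mathrm{diam}(T)$ that contain $T$ as a subgraph and do not contain $k$-special pairs. *)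

(* Defs.v *)
From mathcomp Require Import all_boot.

Set Implicit Arguments.
Unset Strict Implicit.
Unset Printing Implicit Defensive.

Record graph := Graph {
  vertex :> finType;
  adj : rel vertex;
  adj_sym : symmetric adj;
  adj_irr : irreflexive adj
}.

Section Graph.

Variable G : graph.
Implicit Types (x y u v : G) (J : {set G}) (c : seq G).

Definition connected := forall x y, connect (@adj G) x y.

(* A cycle of a graph is a duplicate-free cyclic sequence of length at least 3;
   [:: x; y] with x, y adjacent also satisfies [ucycle] and must be allowed. *)
Definition acyclic := forall c, ucycle (@adj G) c -> size c < 3.

Definition is_tree := [/\ 0 < #|G|, connected & acyclic].

(* Length of a shortest walk from x to y; the junk value #|G| is taken when
   there is no walk, which never happens in a connected graph. *)
Definition dist x y : nat :=
  find (fun d => [exists p : d.-tuple G, path (@adj G) x p && (last x p == y)])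
       (iota 0 #|G|).

Definition ecc x : nat := \max_(y : G) dist x y.

Definition diam : nat := \max_(x : G) ecc x.

Definition dist_indep (k : nat) J : bool :=
  [forall x in J, forall y in J, (x != y) ==> (k.+1 <= dist x y)].

Definition MDIS (k : nat) J : bool := maxset (dist_indep k) J.

Definition num_MDIS (k : nat) : nat := #|[set J | MDIS k J]|.

Definition ball (k : nat) v : {set G} := [set u | dist v u <= k].

Definition twin (k : nat) u : bool :=
  [exists v, (v != u) && (ball k u == ball k v)].

Definition leaf x : bool := #|[set y | adj x y]| == 1.

Definition diametral_leaf x : bool :=
  leaf x && [forall y, leaf y ==> (ecc y <= ecc x)].

Definition diametral_twin (k : nat) x : bool := diametral_leaf x && twin k x.

Definition special_pair (k : nat) x y : bool :=
  [&& diametral_leaf x, diametral_leaf y, twin k x, twin k y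
    & ball k x != ball k y].

End Graph.

Definition isomorphic (G H : graph) : Prop :=
  exists2 f : G -> H, bijective f & forall x y, adj (f x) (f y) = adj x y.

(* Subgraphs need not be induced. *)
Definition contains_subgraph (G T : graph) : Prop :=
  exists2 f : T -> G, injective f & forall x y, adj x y -> adj (f x) (f y).

Definition minimal_tree (k n : nat) (G : graph) : Prop :=
  [/\ is_tree G, #|G| = n &
      forall H : graph, is_tree H -> #|H| = n -> num_MDIS G k <= num_MDIS H k].

(* The two families are only meant for trees T without diametral k-twins. *)
Definition Add (k : nat) (T : graph) (r : nat) (G : graph) : Prop :=
  [/\ is_tree G, #|G| = #|T| + r, diam G = diam T, contains_subgraph G T &
      forall x : G, ~~ diametral_twin k x].

Definition Add_star (k : nat) (T : graph) (r : nat) (G : graph) : Prop :=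
  [/\ is_tree G, #|G| = #|T| + r, diam G = diam T, contains_subgraph G T &
      forall x y : G, ~~ special_pair k x y].

Definition fk (k n : nat) : nat :=
  if n <= k + 1 then n else n - (n - k %% 2) %/ (k %/ 2 + 1) + 1.

Definition consecutive (i j : nat) : bool := (j == i.+1) || (i == j.+1).

Lemma consecutive_sym : symmetric consecutive.
Proof. by move=> i j; rewrite /consecutive orbC. Qed.

Lemma consecutive_irr : irreflexive consecutive.
Proof. by move=> i; rewrite /consecutive orbb ltn_eqF. Qed.

Section PathGraph.

Variable m : nat.

Definition path_adj (i j : 'I_m) : bool := consecutive i j.

Lemma path_adj_sym : symmetric path_adj.
Proof. by move=> i j; apply: consecutive_sym. Qed.

Lemma path_adj_irr : irreflexive path_adj.
Proof. by move=> i; apply: consecutive_irr. Qed.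

Definition path_graph : graph := Graph path_adj_sym path_adj_irr.

End PathGraph.

(* S_{p,m}: [None] is the centre and [Some (i, a)] is the a-th vertex of the
   i-th copy of the m-vertex path, the centre being joined to [Some (i, 0)]. *)
Section Spider.

Variables p m : nat.

Definition spider_adj (x y : option ('I_p * 'I_m)) : bool :=
  match x, y with
  | None, None => false
  | None, Some (_, a) | Some (_, a), None => val a == 0
  | Some (i, a), Some (j, b) => (i == j) && consecutive a b
  end.

Lemma spider_adj_sym : symmetric spider_adj.
Proof. by move=> [[i a]|] [[j b]|] //=; rewrite eq_sym consecutive_sym. Qed.

Lemma spider_adj_irr : irreflexive spider_adj.
Proof. by move=> [[i a]|] //=; rewrite consecutive_irr andbF. Qed.

Definition spider : graph := Graph spider_adj_sym spider_adj_irr.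

End Spider.

Section DeleteVertex.

Variables (G : graph) (v : G).

Definition delete_adj (x y : {x : G | x != v}) : bool := adj (val x) (val y).

Lemma delete_adj_sym : symmetric delete_adj.
Proof. by move=> x y; apply: adj_sym. Qed.

Lemma delete_adj_irr : irreflexive delete_adj.
Proof. by move=> x; apply: adj_irr. Qed.

Definition delete_vertex : graph := Graph delete_adj_sym delete_adj_irr.

End DeleteVertex.

(* Main.v *)
Require Import Defs.
From mathcomp Require Import all_boot.
From mathcomp Require Import perm zify.

(** Write [k = s.*2], and call two vertices near if their distance is at most
    [k]. The [k]-MDISs of a tree are the maximal independent sets of the
    nearness relation, and everything rests on two facts about it.

    Chordality. By the four-point condition ([four_point]), a vertex of [W] that
    is farthest from some root is simplicial in [W]: the vertices of [W] near
    it are pairwise near. A maximal independent set has exactly one vertex [u]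
    near a simplicial vertex [x], and the rest of it is a maximal independent
    set of what is far from [u]. So the number of maximal independent sets is
    at least a sum of positive terms indexed by the vertices near [x]
    ([card_mis_simplicial]). Repeating this on the term of [x] gives an
    independent set [I] such that the tree has at least [n - #|I| + 1] MDISs
    ([card_mis_indep]), and at least [n - #|I| + 2] if some other term of the
    first sum exceeds 1 ([card_mis_gain]).

    Packing. As [k = s.*2], the balls of radius [s] around the vertices of [I]
    are disjoint, so [#|I| <= P] where [P = n %/ s.+1] ([card_packing]).

    Together they give the lower bound [n - P + 1], which is [fk k n] when
    [n >= k + 2], and they make trees attaining it rigid: they have an
    independent set of [P] vertices, and a simplicial vertex has no second near
    vertex that leaves two vertices undominated which are near each other
    ([optimal_no_gain]). The latter excludes diameters above [k + 2],
    diametral twins when the diameter is [k + 2] and special pairs when it is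
    [k + 1]. When the diameter is [k + 2], the geodesics from the centre to the
    independent set form the spider with at most one leaf missing
    ([contains_spider_minus_leaf]); when it is [k + 1], parity shows that
    [P <= 2].

    Conversely, the trees of the two families have an independent set whose
    complement is pairwise near. For such trees the maximal independent sets
    are easily bounded from above ([card_mis_split]), and the bound equals the
    lower one ([no_special_optimal], [no_twin_optimal]). The same argument gives
    a tree of every order [n >= k + 2] that attains the bound
    ([filled_spider_optimal]). When [n <= k + 1], all vertices are pairwise near
    and the MDISs are the singletons.

    The metric of trees is obtained from the fact that an edge separates the
    vertices nearer to one of its ends from those nearer to the other
    ([edge_split]). *)

Set Implicit Arguments.
Unset Strict Implicit.
Unset Printing Implicit Defensive.

(** * Distance in a connected graph *)

Section Distance.

Variable G : graph.
Implicit Types (x y z u w : G) (p : seq G).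

Lemma dist_le_path x p : path (@adj G) x p -> dist x (last x p) <= size p.
Proof.
move=> pth; rewrite leqNgt; apply/negP=> lt.
(* Walks longer than the junk value of [dist] need no separate treatment. *)
have le: dist x (last x p) <= #|G|.
  by rewrite -[X in _ <= X](size_iota 0) find_size.
have := before_find 0 lt.
rewrite nth_iota ?add0n /=; last exact: leq_trans lt le.
case/existsP; exists (in_tuple p).
by rewrite /= pth eqxx.
Qed.

Lemma dist0 x : dist x x = 0.
Proof. by apply/eqP; rewrite -leqn0; exact: (@dist_le_path x [::]). Qed.

Lemma adj_dist x y : adj x y -> dist x y <= 1.
Proof. by move=> xy; apply: (@dist_le_path x [:: y]); rewrite /= xy. Qed.

Hypothesis Gc : connected G.

Lemma dist_lt_card x y : dist x y < #|G|.
Proof.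
have /connectP[p pth ->] := Gc x y.
have /shortenP[q qth qu _] := pth.
apply: leq_ltn_trans (dist_le_path qth) _.
by rewrite -[size q < _]/(size (x :: q) <= _) -(card_uniqP qu) max_card.
Qed.

Lemma geodesic x y :
  exists p, [/\ path (@adj G) x p, last x p = y & size p = dist x y].
Proof.
have lt := dist_lt_card x y.
have hs : has (fun d => [exists p : d.-tuple G,
    path (@adj G) x p && (last x p == y)]) (iota 0 #|G|).
  by rewrite has_find size_iota.
have := nth_find 0 hs; rewrite -/(dist x y) nth_iota // add0n.
case/existsP=> p /andP[pth /eqP lst].
by exists p; rewrite size_tuple.
Qed.

Lemma dist_eq0 x y : (dist x y == 0) = (x == y).
Proof.
apply/eqP/eqP=> [d0|->]; last exact: dist0.
have [p [_ lst]] := geodesic x y; rewrite d0 => sz.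
by case: p lst sz => [|? ?].
Qed.

Lemma dist_tri y x z : dist x z <= dist x y + dist y z.
Proof.
have [p [pp <- <-]] := geodesic x y.
have [q [qp <- <-]] := geodesic (last x p) z.
by rewrite -size_cat -last_cat dist_le_path // cat_path pp.
Qed.

Lemma dist_sym x y : dist x y = dist y x.
Proof.
suff le (a b : G) : dist a b <= dist b a by apply/eqP; rewrite eqn_leq !le.
have [p [pp <- <-]] := geodesic b a.
have := @dist_le_path (last b p) (rev (belast b p)).
rewrite rev_path (eq_path (e' := @adj G)); last by move=> ? ?; rewrite adj_sym.
rewrite size_rev size_belast => /(_ pp).
case: p {pp} => [|c p]; first by rewrite /= dist0.
by rewrite /= rev_cons last_rcons.
Qed.

Lemma adj_dist1 x y : adj x y -> dist x y = 1.
Proof.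
move=> xy; apply/eqP; rewrite eqn_leq adj_dist //= lt0n dist_eq0.
by apply: contraTneq xy => ->; rewrite adj_irr.
Qed.

Lemma dist1_adj x y : dist x y = 1 -> adj x y.
Proof.
move=> d1; have [p [pp lst]] := geodesic x y; rewrite d1 => sz.
by case: p sz pp lst => [|z [|? ?]] //= _ /andP[xz _] <-.
Qed.

Lemma geodesic_step x y d : dist x y = d.+1 ->
  exists2 z, adj x z & dist z y = d.
Proof.
move=> xy; have [[|z p] [pp /= lst]] := geodesic x y; rewrite xy //= => -[sz].
case/andP: pp => xz pp; exists z => //.
have := dist_le_path pp; rewrite lst sz => le.
have := dist_tri z x y; rewrite (adj_dist1 xz); lia.
Qed.

Lemma geodesic_nth x p i : path (@adj G) x p -> size p = dist x (last x p) ->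
  i <= size p ->
  dist x (nth x (x :: p) i) = i /\
  dist (nth x (x :: p) i) (last x p) = size p - i.
Proof.
move=> pp sz ip.
have t1 : path (@adj G) x (take i p) by apply: take_path.
have e1 : last x (take i p) = nth x (x :: p) i.
  rewrite (last_nth x) size_takel //.
  by rewrite -[x :: _]/(take i.+1 (x :: p)) nth_take.
have t2 : path (@adj G) (last x (take i p)) (drop i p).
  by move: pp; rewrite -{1}(cat_take_drop i p) cat_path => /andP[].
have e2 : last (last x (take i p)) (drop i p) = last x p.
  by rewrite -last_cat cat_take_drop.
have := dist_le_path t2; have := dist_le_path t1.
rewrite e2 e1 size_drop size_takel // => l1 l2.
have := dist_tri (nth x (x :: p) i) x (last x p); lia.
Qed.

Lemma geodesic_uniq x p : path (@adj G) x p -> size p = dist x (last x p) ->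
  uniq (x :: p).
Proof.
move=> pp sz; apply/(uniqP x) => i j; rewrite !inE !ltnS => ip jp ij.
by rewrite -(proj1 (geodesic_nth pp sz ip)) ij (proj1 (geodesic_nth pp sz jp)).
Qed.

Lemma dist_mid x y i : i <= dist x y ->
  exists2 z, dist x z = i & dist z y = dist x y - i.
Proof.
have [p [pp lst sz]] := geodesic x y; rewrite -sz => ip.
have [|d1 d2] := geodesic_nth pp _ ip; first by rewrite lst.
by exists (nth x (x :: p) i) => //; rewrite -lst.
Qed.

Lemma lipschitz_dist (g : G -> nat) :
  (forall x y, adj x y -> g x <= g y + 1) ->
  forall x y, g x <= g y + dist x y.
Proof.
move=> gl x y; have [p [pp <- <-]] := geodesic x y.
elim: p x pp => [|z p IH] x /=; first by rewrite addn0.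
case/andP=> xz /IH; have := gl _ _ xz; lia.
Qed.

Lemma dist_le_diam x y : dist x y <= diam G.
Proof.
apply: leq_trans (leq_bigmax (x : G)).
exact: (leq_bigmax (F := dist x) y).
Qed.

Lemma diam_le d : (forall x y, dist x y <= d) -> diam G <= d.
Proof. by move=> H; apply/bigmax_leqP=> x _; apply/bigmax_leqP=> y _. Qed.

Lemma dist_le_ecc x y : dist x y <= ecc x.
Proof. exact: (leq_bigmax (F := dist x) y). Qed.

Lemma ecc_le_diam x : ecc x <= diam G.
Proof. exact: (leq_bigmax x). Qed.

Lemma ecc_attained x : exists y, dist x y = ecc x.
Proof.
have [|y e] := @eq_bigmax _ (dist x); first by apply/card_gt0P; exists x.
by exists y.
Qed.

Lemma diam_attained : 0 < #|G| -> exists x y, dist x y = diam G.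
Proof.
move=> G0; have [x e] := @eq_bigmax _ (@ecc G) G0.
by have [y ey] := ecc_attained x; exists x, y; rewrite ey.
Qed.

End Distance.

(** * The metric of a tree *)

Section TreeMetric.

Variable G : graph.
Hypothesis Gt : is_tree G.
Implicit Types (x y z u w : G) (p : seq G).

Let Gc : connected G. Proof. by case: Gt. Qed.

(** Without the edge [x x'] no walk leads from [x] to [x'], as it would close a
    cycle; [S] is the part of the tree that remains attached to [x]. *)
Lemma bridge x x' : adj x x' -> exists S : pred G,
  [/\ S x, ~~ S x' & forall u w, S u -> ~~ S w ->
      dist u x + 1 + dist x' w <= dist u w].
Proof.
move=> xx'.
pose e' := [rel y z : G | adj y z &&
   ~~ (((y == x) && (z == x')) || ((y == x') && (z == x)))].
have nx : ~~ connect e' x x'.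
  apply/negP=> /connectP[p0 pth0 lst0].
  case/shortenP: pth0 lst0 => p pth pu _ lst.
  have [_ _ acy] := Gt.
  have := acy (x :: p); rewrite /ucycle pu andbT /= rcons_path.
  rewrite (sub_path _ pth); last by move=> ? ? /= /andP[].
  rewrite -lst adj_sym xx' /= => /(_ isT).
  case: p pth lst {pu} => [|z [|//]] /=.
    by move=> _ e; rewrite e adj_irr in xx'.
  by rewrite andbT => pth e _; move: pth; rewrite e !eqxx andbF.
exists (connect e' x); split=> // u w Su Sw.
have [p [pp lst <-]] := geodesic Gc u w.
elim: p u pp lst Su => [|z p IH] u /=; first by move=> _ -> ; rewrite (negbTE Sw).
case/andP=> uz pp lst Su; have [e|ne] := boolP (e' u z).
  have uz' : connect e' u z by apply: connect1.
  have := IH z pp lst (connect_trans Su uz').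
  have := dist_tri Gc z u x; rewrite (adj_dist1 Gc uz); lia.
move: ne; rewrite /= uz /= negbK => /orP[] /andP[/eqP eu /eqP ez].
  by rewrite eu dist0 add0n add1n ltnS -lst -ez dist_le_path.
by rewrite -eu Su in nx.
Qed.

(** A vertex lies on the side of the nearer end of the edge [x x'], and every
    walk from one side to the other uses the edge. *)
Lemma edge_split x x' u w : adj x x' -> dist u x < dist u x' ->
  dist w x' <= dist w x -> dist u w = dist u x + 1 + dist x' w.
Proof.
move=> xx' ux wx; have [S [Sx Sx' SS]] := bridge xx'.
have Su : S u.
  apply: contraLR ux => Su; have := SS x u Sx Su.
  rewrite dist0 -leqNgt !(dist_sym Gc _ u); lia.
have Sw : ~~ S w.
  apply: contraTN wx => Sw; have := SS w x' Sw Sx'.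
  rewrite dist0 -ltnNge; lia.
apply/eqP; rewrite eqn_leq SS // andbT.
have := dist_tri Gc x u w; have := dist_tri Gc x' x w.
rewrite (adj_dist1 Gc xx'); lia.
Qed.

Lemma adj_dist_neq x x' u : adj x x' -> dist u x != dist u x'.
Proof.
move=> xx'; apply/eqP=> e; have [S [Sx Sx' SS]] := bridge xx'.
have [Su|Su] := boolP (S u).
  by have := SS u x' Su Sx'; rewrite dist0; lia.
have := SS x u Sx Su; rewrite dist0 !(dist_sym Gc _ u); lia.
Qed.

Lemma adj_dist_le x x' u : adj x x' -> dist u x <= dist u x' + 1.
Proof.
by move=> xx'; have := dist_tri Gc x' u x; rewrite (dist_sym Gc x') (adj_dist1 Gc xx').
Qed.

(** The four-point condition, which says that trees are 0-hyperbolic. *)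
Lemma four_point u w x r :
  dist u w + dist x r <= maxn (dist u x + dist w r) (dist w x + dist u r).
Proof.
(* Move [x] one edge towards [r]: if [u] or [w] is left behind, [x] lies
   between it and [r]; otherwise all distances drop together. *)
move e : (dist x r) => d; elim: d x e => [|d IH] x e.
  have /eqP : dist x r == 0 by rewrite e.
  rewrite addn0 => /eqP; rewrite dist_eq0 // => /eqP ->.
  have := dist_tri Gc r u w; rewrite (dist_sym Gc r w); lia.
have [x' xx' e'] := geodesic_step Gc e.
have left a : dist a x < dist a x' -> dist a r = dist a x + d.+1.
  move=> ax; rewrite (edge_split xx' ax); first by rewrite e' -addnA add1n.
  by rewrite !(dist_sym Gc r) e e'.
have [ux|ux] := ltnP (dist u x) (dist u x').
  have := left _ ux; have := dist_tri Gc x u w; rewrite (dist_sym Gc x w); lia.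
have [wx|wx] := ltnP (dist w x) (dist w x').
  have := left _ wx; have := dist_tri Gc x u w; rewrite (dist_sym Gc x w); lia.
have := adj_dist_neq u xx'; have := adj_dist_neq w xx'; have := IH x' e'; lia.
Qed.

(** Trees are bipartite. *)
Lemma dist_parity r x y : odd (dist x y) = odd (dist r x) (+) odd (dist r y).
Proof.
move e : (dist x y) => d; elim: d x e => [|d IH] x e.
  have /eqP : dist x y == 0 by rewrite e.
  by move/eqP; rewrite dist_eq0 // => /eqP ->; rewrite addbb.
have [x' xx' e'] := geodesic_step Gc e.
have := adj_dist_neq r xx'; have := adj_dist_le r xx'.
have := @adj_dist_le x' x r; rewrite adj_sym xx' => /(_ isT).
have := IH x' e'; rewrite /= => ->.
move=> a b c; have : dist r x = (dist r x').+1 \/ dist r x' = (dist r x).+1 by lia.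
by case=> -> /=; case: odd; case: odd.
Qed.

Lemma closer_neighbour_unique z x x' l : adj z x -> adj z x' ->
  dist x l < dist z l -> dist x' l < dist z l -> x = x'.
Proof.
move=> zx zx' xl x'l; apply/eqP; apply/negPn/negP=> ne.
have xz : adj x z by rewrite adj_sym.
have := adj_dist_neq x' xz; rewrite (dist_sym Gc x' z) (adj_dist1 Gc zx').
have : dist x' x != 0 by rewrite dist_eq0 // eq_sym.
have := adj_dist_le l zx; have := edge_split (u := l) (w := x') xz.
rewrite !(dist_sym Gc l) (dist_sym Gc x' z) (adj_dist1 Gc zx'); lia.
Qed.

(** A path that does not turn back moves away from its endpoint at every step,
    as a vertex has only one neighbour on the way to that endpoint. *)
Lemma uniq_path_geodesic x p : path (@adj G) x p -> uniq (x :: p) ->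
  dist x (last x p) = size p.
Proof.
elim: p x => [|z p IH] x /=; first by rewrite dist0.
case/andP=> xz pp /andP[xn pu]; have dz := IH z pp pu.
have zx : adj z x by rewrite adj_sym.
have := adj_dist_neq (last z p) xz; rewrite !(dist_sym Gc (last z p)).
have := adj_dist_le (last z p) xz; rewrite !(dist_sym Gc (last z p)) dz.
suff: ~~ (dist x (last z p) < dist z (last z p)) by rewrite dz; lia.
apply/negP=> lt; case: p pp xn pu dz lt {IH} => [|z' p] /=.
  by rewrite dist0.
case/andP=> zz' pp xn /andP[zn pu] dz lt.
have e : x = z'.
  apply: (closer_neighbour_unique zx zz' lt).
  by rewrite dz ltnS dist_le_path.
by rewrite e !inE eqxx orbT in xn.
Qed.

End TreeMetric.

(** * Maximal independent sets of a chordal relation *)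

Section MaximalIndependentSets.

Variables (V : finType) (e : rel V).
Hypotheses (e_sym : symmetric e) (e_refl : reflexive e).
Implicit Types (W I J C : {set V}) (u w x : V).

Definition indep J : bool :=
  [forall x in J, forall y in J, (x != y) ==> ~~ e x y].

Definition clique C := {in C &, forall x y, e x y}.

(** The maximal independent subsets of [W]; as [e] is reflexive, an independent
    set is maximal iff it dominates [W]. *)
Definition mis W : {set {set V}} :=
  [set J : {set V} |
    [&& J \subset W, indep J & [forall w in W, exists u in J, e u w]]].

Definition far W u : {set V} := [set w in W | ~~ e u w].

Definition simplicial W x := clique [set u in W | e x u].

Lemma indepP J : reflect {in J &, forall x y, e x y -> x = y} (indep J).
Proof.
apply: (iffP forall_inP) => [H x y xJ yJ exy|H x xJ].
  by have /forall_inP/(_ y yJ) := H x xJ; rewrite exy implybF negbK => /eqP.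
apply/forall_inP=> y yJ; apply/implyP; apply: contra => exy.
by apply/eqP; apply: H.
Qed.

Lemma misP W J : reflect
  [/\ J \subset W, indep J & forall w, w \in W -> exists2 u, u \in J & e u w]
  (J \in mis W).
Proof.
rewrite inE; apply: (iffP and3P) => -[JW Ji JD]; split=> //.
  by move=> w wW; have /forall_inP/(_ w wW)/exists_inP := JD.
by apply/forall_inP=> w /JD/exists_inP.
Qed.

Lemma mis_maxset J : maxset indep J = (J \in mis setT).
Proof.
apply/maxsetP/misP => [[Ji Jm]|[_ Ji Jd]]; split=> //.
- move=> w _; have [wJ|wJ] := boolP (w \in J); first by exists w.
  apply/exists_inP; apply: contraNT wJ; rewrite negb_exists_in => /forall_inP H.
  suff: w |: J = J by move=> <-; apply: setU11.
  apply: Jm; last exact: subsetUr.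
  apply/indepP => x y /setU1P[->|xJ] /setU1P[->|yJ] //.
  + by rewrite e_sym (negbTE (H _ yJ)).
  + by rewrite (negbTE (H _ xJ)).
  + by move/indepP: Ji; apply.
- move=> B Bi JB; apply/eqP; rewrite eqEsubset JB andbT.
  apply/subsetP=> x xB; have [u uJ ux] := Jd x (in_setT x).
  by move/indepP: Bi => /(_ u x (subsetP JB u uJ) xB ux) <-.
Qed.

Lemma indepU1 I W x : indep I -> I \subset far W x -> indep (x |: I).
Proof.
move=> /indepP Ii /subsetP IW; apply/indepP=> u w.
case/setU1P=> [->|uI] /setU1P[->|wI] // euw; last exact: Ii.
  by have := IW _ wI; rewrite inE euw andbF.
by have := IW _ uI; rewrite inE e_sym euw andbF.
Qed.

Lemma misU1 W x J : x \in W -> J \in mis (far W x) -> x |: J \in mis W.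
Proof.
move=> xW /misP[JW Ji Jd]; apply/misP; split.
- rewrite subUset sub1set xW (subset_trans JW) //.
  by apply/subsetP=> w; rewrite inE => /andP[].
- exact: indepU1 JW.
move=> w wW; have [xw|xw] := boolP (e x w); first by exists x; rewrite ?setU11.
have [|u uJ uw] := Jd w; first by rewrite inE wW.
by exists u => //; apply: setU1r.
Qed.

Lemma far_notin W x J : J \subset far W x -> x \notin J.
Proof. by move/subsetP=> H; apply/negP=> /H; rewrite inE e_refl andbF. Qed.

Lemma card_far W x : x \in W -> #|far W x| < #|W|.
Proof.
move=> xW; apply: proper_card; apply/properP; split.
  by apply/subsetP=> w; rewrite inE => /andP[].
by exists x => //; rewrite inE e_refl andbF.
Qed.

Lemma mis_nonempty W : exists J, J \in mis W.
Proof.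
move en : #|W| => n; elim/ltn_ind: n W en => n IH W en.
have [->|[x xW]] := set_0Vmem W.
  exists set0; apply/misP; split; rewrite ?sub0set //; last by move=> w; rewrite inE.
  by apply/indepP=> x y; rewrite inE.
have [J Jm] := IH _ (leq_trans (card_far xW) (eq_leq en)) _ erefl.
by exists (x |: J); apply: misU1.
Qed.

Lemma mis_through W x : x \in W -> exists2 J, J \in mis W & x \in J.
Proof.
move=> xW; have [J Jm] := mis_nonempty (far W x).
by exists (x |: J); [apply: misU1 | apply: setU11].
Qed.

Lemma card_mis_gt0 W : 0 < #|mis W|.
Proof. by apply/card_gt0P; have [J Jm] := mis_nonempty W; exists J. Qed.

Lemma card_mis_gt1 W a b : a \in W -> b \in W -> a != b -> e a b ->
  1 < #|mis W|.
Proof.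
move=> aW bW ab eab; apply/card_gt1P.
have [J Jm aJ] := mis_through aW; have [K Km bK] := mis_through bW.
exists J, K; split=> //; apply: contraNneq ab => JK; apply/eqP.
by have /misP[_ /indepP Ki _] := Km; apply: Ki => //; rewrite -JK.
Qed.

(** A maximal independent set contains exactly one vertex of the neighbourhood
    of a simplicial vertex, and what is left of it is arbitrary. *)
Lemma card_mis_simplicial W x : simplicial W x ->
  \sum_(u in [set u in W | e x u]) #|mis (far W u)| <= #|mis W|.
Proof.
move=> xs; set C := [set _ in _ | _].
have le u : u \in C -> #|mis (far W u)| <= \sum_(J in mis W) (u \in J).
  move=> uC; have uW : u \in W by move: uC; rewrite /C inE => /andP[].
  rewrite -big_mkcondr sum1_card -(card_in_imset (f := fun J => u |: J)).
    apply: subset_leq_card; apply/subsetP=> _ /imsetP[J Jm ->].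
    by apply/andP; split; rewrite ?misU1 ?setU11.
  move=> J K /misP[/far_notin Ju _ _] /misP[/far_notin Ku _ _] JK.
  by rewrite -(setU1K Ju) -(setU1K Ku) JK.
apply: (@leq_trans (\sum_(u in C) \sum_(J in mis W) (u \in J))).
  exact: leq_sum.
rewrite exchange_big /= -sum1_card; apply: leq_sum => J /misP[_ /indepP Ji _].
rewrite -big_mkcondr sum1_card; apply/card_le1_eqP => u w.
case/andP=> uC uJ /andP[wC wJ]; apply: Ji => //.
by apply: xs.
Qed.

Lemma card_far_split W x : #|[set u in W | e x u]| + #|far W x| = #|W|.
Proof.
rewrite -(cardsID [set u | e x u] W); congr (_ + _); apply: eq_card => u.
  by rewrite !inE.
by rewrite !inE andbC.
Qed.

Hypothesis chordal :
  forall W, W != set0 -> exists2 x, x \in W & simplicial W x.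

(** The terms of the previous sum are positive; [g] records by how much they are
    known to exceed 1. *)
Lemma mis_step W x (g : V -> nat) : x \in W -> simplicial W x ->
  (forall u, u \in W -> e x u -> g u < #|mis (far W u)|) ->
  #|mis (far W x)| + #|[set u in W | e x u]| +
    \sum_(u in [set u in W | e x u] | u != x) g u <= #|mis W| + 1.
Proof.
move=> xW xs gl; have := card_mis_simplicial xs.
set C := [set _ in _ | _]; have xC : x \in C by rewrite /C inE xW e_refl.
rewrite (bigD1 x) //= (cardsD1 x C) xC add1n => le.
suff gle: #|C :\ x| + \sum_(u in C | u != x) g u <=
      \sum_(u in C | u != x) #|mis (far W u)|.
  by have := leq_trans (leq_add (leqnn _) gle) le; lia.
have -> : #|C :\ x| = \sum_(u in C | u != x) 1.
  by rewrite sum1_card; apply: eq_card => u;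
     rewrite in_setD1 andbC.
rewrite -big_split /=; apply: leq_sum => u /andP[].
by rewrite /C inE => /andP[uW xu] _; rewrite add1n; apply: gl.
Qed.

(** Peel off simplicial vertices: each neighbourhood [C] that is removed costs
    one vertex of [I] and accounts for [#|C| - 1] sets. *)
Lemma card_mis_indep W : exists I,
  [/\ I \subset W, indep I & #|W| + 1 <= #|mis W| + #|I|].
Proof.
move en : #|W| => n; elim/ltn_ind: n W en => n IH W en.
have [W0|W0] := eqVneq W set0.
  exists set0; rewrite sub0set -en W0 cards0; split=> //.
    by apply/indepP=> x y; rewrite inE.
  by rewrite addn0 add0n card_mis_gt0.
have [x xW xs] := chordal W0.
have [I [IW Ii Ic]] := IH _ (leq_trans (card_far xW) (eq_leq en)) _ erefl.
exists (x |: I); split; last 1 first.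
- have := mis_step (g := fun=> 0) xW xs (fun u _ _ => card_mis_gt0 _).
  rewrite big1_eq cardsU1 (far_notin IW) -en -(card_far_split W x); lia.
- rewrite subUset sub1set xW (subset_trans IW) //.
  by apply/subsetP=> w; rewrite inE => /andP[].
exact: indepU1 IW.
Qed.

(** In the sum over the neighbours of [x], the term of [u] is at least 2, as [a]
    and [b] belong to different maximal independent subsets of [far setT u]. *)
Lemma card_mis_gain x u a b : simplicial setT x -> u != x -> e x u ->
  ~~ e u a -> ~~ e u b -> a != b -> e a b ->
  exists2 I, indep I & #|V| + 2 <= #|mis setT| + #|I|.
Proof.
move=> xs ux xu ua ub ab eab.
have [I [IW Ii Ic]] := card_mis_indep (far setT x).
exists (x |: I); first exact: indepU1 IW.
have := mis_step (g := fun w => w == u) (in_setT x) xs.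
have -> : \sum_(w in [set w in setT | e x w] | w != x) (w == u : nat) = 1.
  rewrite (bigD1 u) /=; last by rewrite inE in_setT xu.
  by rewrite eqxx big1 // => w /andP[_ /negbTE ->].
move=> H; have := H _; rewrite cardsU1 (far_notin IW) -cardsT.
rewrite -(card_far_split setT x) => {}H.
suff gl : forall w, w \in setT -> e x w -> (w == u) < #|mis (far setT w)|.
  by have := H gl; lia.
move=> w _ xw; have [->|_] := eqVneq w u; last exact: card_mis_gt0.
by apply: (card_mis_gt1 (a := a) (b := b)); rewrite ?inE ?in_setT.
Qed.

(** If [e] is split into an independent set [I] and a clique, a maximal
    independent set other than [I] has exactly one vertex outside [I], which
    determines it. *)
Lemma card_mis_split I : indep I -> clique (~: I) ->
  #|mis setT| <= #|V| - #|I| + (I \in mis setT).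
Proof.
move=> /indepP Ii Ic; pose f u := u |: [set a in I | ~~ e a u].
have sub : mis setT \subset (f @: ~: I) :|: (if I \in mis setT then [set I] else set0).
  apply/subsetP=> J Jm; have /misP[_ /indepP Ji Jd] := Jm.
  apply/setUP; have [JI|] := boolP (J \subset I).
    suff <- : J = I by right; rewrite Jm set11.
    apply/eqP; rewrite eqEsubset JI; apply/subsetP=> a aI.
    have [b bJ ba] := Jd a (in_setT a).
    by rewrite -(Ii b a (subsetP JI b bJ) aI ba).
  case/subsetPn=> u uJ uI; left; apply/imsetP; exists u.
    by rewrite inE.
  apply/setP=> a; rewrite !inE; apply/idP/idP => [aJ|].
    have [aI|aI] := boolP (a \in I); last first.
      by rewrite (Ji a u aJ uJ (Ic _ _ _ _)) ?eqxx // inE.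
    apply/orP; right; apply: contra uI => au.
    by rewrite -(Ji a u aJ uJ au).
  case/orP=> [/eqP -> //|/andP[aI au]].
  have [b bJ ba] := Jd a (in_setT a); have [bI|bI] := boolP (b \in I).
    by rewrite -(Ii b a bI aI ba).
  move: au; rewrite e_sym -(Ji b u bJ uJ) ?ba //.
  by apply: Ic; rewrite inE.
apply: leq_trans (subset_leq_card sub) _.
apply: leq_trans (leq_card_setU _ _) _; apply: leq_add.
  apply: leq_trans (leq_imset_card _ _) _.
  by rewrite -(cardsC I) addKn.
by case: ifP; rewrite ?cards1 ?cards0.
Qed.

End MaximalIndependentSets.

(** * Nearness in a tree *)

Section TreePower.

Variable G : graph.
Hypothesis Gt : is_tree G.
Implicit Types (x y z u w a b r : G) (I J W : {set G}).

Let Gc : connected G. Proof. by case: Gt. Qed.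

Definition near k x y : bool := dist x y <= k.

Variable k : nat.

Let near_sym : symmetric (near k).
Proof. by move=> x y; rewrite /near dist_sym. Qed.

Let near_refl : reflexive (near k).
Proof. by move=> x; rewrite /near dist0. Qed.

Lemma num_MDISE : num_MDIS G k = #|mis (near k) setT|.
Proof.
apply: eq_card => J; rewrite inE -mis_maxset // /MDIS; apply: maxset_eq => {}J.
rewrite /dist_indep /indep; apply: eq_forallb => x; congr (_ ==> _).
apply: eq_forallb => y; congr (_ ==> _); congr (_ ==> _).
by rewrite /near -ltnNge.
Qed.

Lemma indep_nearP J :
  reflect {in J &, forall x y, x != y -> k < dist x y} (indep (near k) J).
Proof.
apply: (iffP (indepP _ _)) => H x y xJ yJ.
  by rewrite ltnNge; apply: contraNN => /(H _ _ xJ yJ) ->.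
by move=> xy; apply/eqP; apply: contraTT xy => /(H _ _ xJ yJ); rewrite ltnNge.
Qed.

(** By the four-point condition, the neighbours of a vertex farthest from [r]
    are no farther from each other than from it. *)
Lemma farthest_simplicial W r x :
  {in W, forall u, dist r u <= dist r x} -> simplicial (near k) W x.
Proof.
move=> xmax u w; rewrite !inE /near => /andP[uW xu] /andP[wW xw].
have := four_point Gt u w x r.
rewrite !(dist_sym Gc _ r) (dist_sym Gc u x) (dist_sym Gc w x).
have := xmax u uW; have := xmax w wW; lia.
Qed.

Lemma near_chordal W : W != set0 ->
  exists2 x, x \in W & simplicial (near k) W x.
Proof.
case/set0Pn=> r rW; case: (arg_maxnP (dist r) rW) => x xW xmax.
by exists x => //; apply: (@farthest_simplicial _ r).
Qed.

Lemma diam_simplicial x y : dist x y = diam G -> simplicial (near k) setT x.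
Proof.
move=> xy; apply: (@farthest_simplicial _ y) => u _.
by rewrite (dist_sym Gc y x) xy dist_le_diam.
Qed.

Lemma simplicial_near x u w : simplicial (near k) setT x ->
  dist x u <= k -> dist x w <= k -> dist u w <= k.
Proof. by move=> xs xu xw; apply: xs; rewrite !inE. Qed.

Lemma simplicial_twins x y : simplicial (near k) setT x ->
  simplicial (near k) setT y -> dist x y <= k -> ball k x = ball k y.
Proof.
move=> xs ys xy; apply/setP=> z; rewrite !inE; apply/idP/idP.
  exact: simplicial_near.
by apply: simplicial_near ys _; rewrite dist_sym.
Qed.

Lemma card_ball_geodesic s x y : s <= dist x y -> s < #|ball s x|.
Proof.
move=> sd; have [p [pp lst sz]] := geodesic Gc x y.
have dn i : i <= s -> dist x (nth x (x :: p) i) = i.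
  by move=> is_; case: (geodesic_nth Gc (i := i) pp); rewrite ?lst ?sz //; lia.
have sub : [set nth x (x :: p) i | i : 'I_s.+1] \subset ball s x.
  by apply/subsetP=> _ /imsetP[i _ ->]; rewrite inE dn -ltnS.
apply: leq_trans (subset_leq_card sub).
rewrite card_imset ?card_ord // => i j ij; apply: val_inj => /=.
by rewrite -(dn i) ?ij ?dn // -ltnS.
Qed.

Lemma card_near_mis : exists2 I, indep (near k) I &
  #|G| + 1 <= num_MDIS G k + #|I|.
Proof.
have [I [_ Ii le]] := card_mis_indep near_sym near_refl near_chordal setT.
by exists I; rewrite // num_MDISE -cardsT.
Qed.

Lemma neighbour_exists x : 1 < #|G| -> exists y, adj x y.
Proof.
move=> G1; have [y xy] : exists y, y != x.
  have /card_gt1P[a [b [_ _ ab]]] := G1.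
  by have [ax|ax] := eqVneq a x; [exists b; rewrite -ax eq_sym | exists a].
have : dist x y != 0 by rewrite dist_eq0 // eq_sym.
case e : (dist x y) => [//|d] _.
by have [z] := geodesic_step Gc e; exists z.
Qed.

(** All neighbours of a vertex of maximum eccentricity are closer to a vertex
    at that distance, and a tree has only one such neighbour. *)
Lemma diam_leaf x : 1 < #|G| -> ecc x = diam G -> leaf x.
Proof.
move=> G1 xd; have [y xy] := ecc_attained x; have [z xz] := neighbour_exists x G1.
have closer a : adj x a -> dist a y < dist x y.
  move=> xa; have := adj_dist_neq Gt y xa; rewrite !(dist_sym Gc y) xy xd.
  by have := dist_le_diam a y; lia.
apply/cards1P; exists z; apply/setP=> a; rewrite !inE.
apply/idP/eqP=> [xa|-> //].
by apply: (closer_neighbour_unique Gt xa xz) (closer _ xa) (closer _ xz).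
Qed.

Lemma diametral_leafE x : 1 < #|G| -> diametral_leaf x = (ecc x == diam G).
Proof.
move=> G1; apply/andP/eqP=> [[_ /forallP H]|xd]; last first.
  by split; [exact: diam_leaf | apply/forallP=> y; rewrite xd ecc_le_diam implybT].
have [|a [b ab]] := @diam_attained G; first exact: ltnW.
have ad : ecc a = diam G.
  by apply/eqP; rewrite eqn_leq ecc_le_diam -ab dist_le_ecc.
by have := H a; rewrite (diam_leaf G1 ad) ad /= => ?; apply/eqP; rewrite eqn_leq ecc_le_diam.
Qed.

End TreePower.

(** The balls of radius [s] around the vertices of [I] are disjoint and have at
    least [s.+1] vertices each. *)
Lemma card_packing (G : graph) s (I : {set G}) : is_tree G ->
  s < #|G| -> indep (near s.*2) I ->
  #|I| * s.+1 <= #|G|.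
Proof.
move=> Gt sG Ii; have [_ Gc _] := Gt.
have big (x : G) : x \in I -> s < #|ball s x|.
  move=> xI; have [y xy] := ecc_attained x.
  have [le|lt] := leqP s (dist x y); first exact: card_ball_geodesic le.
  have -> : ball s x = setT; last by rewrite cardsT.
  apply/setP=> z; rewrite !inE; apply: leq_trans (dist_le_ecc x z) _.
  by rewrite -xy ltnW.
have le1 (u : G) : \sum_(x in I) (u \in ball s x) <= 1.
  rewrite -big_mkcondr sum1_card; apply/card_le1_eqP => x y.
  case/andP=> xI + /andP[yI]; rewrite !inE => xu yu.
  apply/eqP/negPn/negP=> xy; move/indep_nearP: Ii => /(_ y x yI xI xy).
  by have := dist_tri Gc u y x; rewrite (dist_sym Gc u x); lia.
rewrite -sum_nat_const; apply: (@leq_trans (\sum_(x in I) #|ball s x|)).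
  exact: leq_sum.
apply: (@leq_trans (\sum_(u : G) 1)); last by rewrite sum1_card.
rewrite (eq_bigr (fun x => \sum_(u : G) (u \in ball s x))).
  by rewrite exchange_big; apply: leq_sum => u _; apply: le1.
by move=> x _; rewrite -big_mkcond sum1_card.
Qed.


(** * Subtrees of a spider *)

(** On a cycle, both neighbours of a vertex of maximum rank would have lower
    rank, and they are distinct if the cycle has length at least 3. *)
Lemma acyclic_rank (G : graph) (r : G -> nat) :
  (forall x y : G, adj x y -> r x != r y) ->
  (forall x y z : G, adj x y -> adj x z -> r y < r x -> r z < r x -> y = z) ->
  acyclic G.
Proof.
move=> rneq rlow c /andP[cyc cu]; rewrite ltnNge; apply/negP=> c3.
have [x0 x0c] : exists x0, x0 \in c.
  by case: c c3 {cyc cu} => [//|a c] _; exists a; apply: mem_head.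
have [x xc xmax] := arg_maxnP (P := mem c) r x0c.
have [i c' ec] := rot_to xc.
move: cyc cu c3; rewrite -(rot_cycle i) -(rot_uniq i) -(size_rot i).
have mem_c a : a \in rot i c -> r a <= r x by rewrite mem_rot => /xmax.
rewrite ec in mem_c *; case: c' mem_c {ec} => [|y [|z c']] //= mem_c.
rewrite rcons_path => /andP[xy /and3P[_ _ lx]] /and3P[_ yn _] _.
suff yl : y = last z c' by rewrite yl mem_last in yn.
have le a : a \in [:: x, y, z & c'] -> adj x a -> r a < r x.
  by move=> ac xa; rewrite ltn_neqAle mem_c // andbT eq_sym rneq.
have xl : adj x (last z c') by rewrite adj_sym.
apply: (rlow x) => //; apply: le => //; first by rewrite !inE eqxx orbT.
by rewrite 2!in_cons mem_last !orbT.
Qed.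

(** The spider with infinitely many infinite legs. Paths, spiders and their
    truncations are subtrees of it that contain its centre [None], so that
    their distances can be bounded all at once. *)
Definition leg_adj (o o' : option (nat * nat)) : bool :=
  match o, o' with
  | None, None => false
  | None, Some (_, a) | Some (_, a), None => a == 0
  | Some (i, a), Some (j, b) => (i == j) && consecutive a b
  end.

Definition depth (o : option (nat * nat)) := if o is Some (_, a) then a.+1 else 0.

Definition leg (o : option (nat * nat)) := if o is Some (i, _) then Some i else None.

Lemma leg_adj_depth o o' : leg_adj o o' ->
  depth o' = (depth o).+1 \/ depth o = (depth o').+1.
Proof.
case: o o' => [[i a]|] [[j b]|] //=; try by move/eqP->; auto.
by case/andP=> _ /orP[] /eqP ->; auto.
Qed.

Section SubSpider.

(** [phi] identifies [G] with a subtree of the infinite spider that contains the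
    centre. *)
Variables (G : graph) (phi : G -> option (nat * nat)) (c : G).
Hypothesis phi_inj : injective phi.
Hypothesis phi_adj : forall x y, adj x y = leg_adj (phi x) (phi y).
Hypothesis phi_c : phi c = None.
Hypothesis phi_down :
  forall x i a, phi x = Some (i, a.+1) -> exists y, phi y = Some (i, a).

Lemma path_to_centre x :
  exists p, [/\ path (@adj G) x p, last x p = c & size p = depth (phi x)].
Proof.
move e : (depth (phi x)) => d; elim: d x e => [|d IH] x.
  case e : (phi x) => [[//]|] _; exists [::]; split=> //=.
  by apply: phi_inj; rewrite phi_c.
case e : (phi x) => [[i [|a]]|] //= -[dd].
  by exists [:: c]; rewrite /= phi_adj e phi_c -dd.
have [y ey] := phi_down e; have [|p [pp lst sz]] := IH y; first by rewrite ey.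
by exists (y :: p); rewrite /= sz pp phi_adj e ey /= eqxx /consecutive eqxx orbT.
Qed.

Lemma sub_spider_tree : is_tree G.
Proof.
split; first by apply/card_gt0P; exists c.
  have cc x : connect (@adj G) x c.
    by have [p [pp <- _]] := path_to_centre x; apply/connectP; exists p.
  move=> x y; apply: connect_trans (cc x) _.
  by rewrite (sym_connect_sym (@adj_sym G)).
apply: (@acyclic_rank _ (fun x => depth (phi x))) => x.
  by move=> y; rewrite phi_adj => /leg_adj_depth; lia.
move=> y z; rewrite !phi_adj => xy xz yx zx; apply: phi_inj.
move: xy xz yx zx; rewrite /consecutive.
case: (phi x) (phi y) (phi z) => [[i a]|] [[j b]|] [[l d]|] //=; rewrite /consecutive; try lia.
by move=> /andP[/eqP <- ab] /andP[/eqP <- ad] ba da; congr (Some (_, _)); lia.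
Qed.

Let Gc : connected G. Proof. by case: sub_spider_tree. Qed.

Lemma dist_centre x : dist x c <= depth (phi x).
Proof. by have [p [pp <- <-]] := path_to_centre x; apply: dist_le_path. Qed.

Lemma dist_le_depth x y : dist x y <= depth (phi x) + depth (phi y).
Proof.
apply: leq_trans (dist_tri Gc c x y) (leq_add (dist_centre x) _).
by rewrite dist_sym // dist_centre.
Qed.

(** The depth, counted positively on the leg of one vertex and negatively
    elsewhere, is 1-Lipschitz. *)
Lemma depth_le_dist x y : leg (phi x) != leg (phi y) ->
  depth (phi x) + depth (phi y) <= dist x y.
Proof.
suff H a b i : leg (phi a) = Some i -> leg (phi b) != Some i ->
    depth (phi a) + depth (phi b) <= dist a b.
  case ex : (leg (phi x)) => [i|]; first by move=> ne; apply: (H _ _ i); rewrite // eq_sym.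
  case ey : (leg (phi y)) => [i|//] _.
  by rewrite addnC dist_sym // (H _ _ i) // ex.
(* The shift by [K] keeps the truncated subtraction exact at [b]. *)
move=> ai bi; pose K := depth (phi b).
pose g z := if leg (phi z) == Some i then K + depth (phi z) else K - depth (phi z).
have := @lipschitz_dist _ Gc g; rewrite /g => /(_ _ a b).
rewrite ai eqxx (negbTE bi) -/K subnn addnC; apply=> z w.
rewrite phi_adj; case: (phi z) (phi w) => [[j u]|] [[l v]|] //=.
- case/andP=> /eqP <- ; rewrite /consecutive; case: ifP; lia.
- by move/eqP->; case: ifP; lia.
- by move/eqP->; case: ifP; lia.
Qed.

End SubSpider.

(** * Trees attaining the lower bound *)

Section Optimal.

Variables (G : graph) (s : nat).
Hypotheses (Gt : is_tree G) (s_gt0 : 0 < s) (sG : s.*2 + 2 <= #|G|).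
Implicit Types (x y z u w a b c : G) (I : {set G}).

Notation k := s.*2.
Notation P := (#|G| %/ s.+1).

Let Gc : connected G. Proof. by case: Gt. Qed.
Let near_sym : symmetric (@near G k).
Proof. by move=> x y; rewrite /near dist_sym. Qed.
Let near_refl : reflexive (@near G k).
Proof. by move=> x; rewrite /near dist0. Qed.
Let P_gt1 : 1 < P. Proof. by rewrite leq_divRL //; lia. Qed.
Let G_gt1 : 1 < #|G|. Proof. by lia. Qed.

(** In this range the right-hand side is [fk k #|G|]; see [fk_double]. *)
Definition optimal := num_MDIS G k <= #|G| - P + 1.

Lemma card_indep_le I : indep (@near G k) I -> #|I| <= P.
Proof. by move=> Ii; rewrite leq_divRL // (card_packing Gt) //; lia. Qed.

Lemma num_MDIS_ge : #|G| - P + 1 <= num_MDIS G k.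
Proof.
have [I Ii le] := card_near_mis Gt k.
by have := card_indep_le Ii; lia.
Qed.

(** Equality in the lower bound forces the independent set there to be as large
    as the packing bound allows. *)
Lemma optimal_indep : optimal -> exists2 I, indep (@near G k) I & #|I| = P.
Proof.
move=> opt; have [I Ii le] := card_near_mis Gt k.
by exists I => //; move: opt (card_indep_le Ii); rewrite /optimal; lia.
Qed.

(** The rigidity of optimal trees: [x] and [u] as in [card_mis_gain] cannot
    exist. *)
Lemma optimal_no_gain x u a b : optimal -> simplicial (@near G k) setT x ->
  u != x -> dist x u <= k -> k < dist u a -> k < dist u b -> a != b ->
  k < dist a b.
Proof.
move=> opt xs ux xu ua ub ab; rewrite ltnNge; apply/negP=> abk.
have [I Ii le] : exists2 I, indep (@near G k) I & #|G| + 2 <= num_MDIS G k + #|I|.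
  rewrite num_MDISE //; apply: (card_mis_gain near_sym near_refl
    (near_chordal Gt k) xs ux (a := a) (b := b)); rewrite /near -?ltnNge //.
by move: opt (card_indep_le Ii); rewrite /optimal; lia.
Qed.

Lemma optimal_diam_gt : optimal -> k < diam G.
Proof.
case/optimal_indep=> I /indep_nearP Ii cI.
have /card_gt1P[x [y [xI yI xy]]] : 1 < #|I| by rewrite cI.
exact: leq_trans (Ii _ _ xI yI xy) (dist_le_diam x y).
Qed.

(** On a longer diametral path [v_0, ..., v_d], the vertex [v_1] is a second
    neighbour of [v_0] that dominates neither [v_(d-1)] nor [v_d]. *)
Lemma optimal_diam_le : optimal -> diam G <= k.+2.
Proof.
move=> opt; rewrite leqNgt; apply/negP=> dk.
have [|x [y xy]] := @diam_attained G; first by lia.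
have [|u xu uy] := dist_mid Gc (x := x) (y := y) (i := 1); first by lia.
have [|a ua ay] := dist_mid Gc (x := u) (y := y) (i := (dist u y).-1); first by lia.
have ne z z' : 0 < dist z z' -> z != z' by rewrite lt0n dist_eq0.
have := @optimal_no_gain x u a y opt (@diam_simplicial _ Gt k _ _ xy).
have -> : u != x by rewrite eq_sym ne ?xu.
by have -> : a != y; [apply: ne | ]; lia.
Qed.

(** A twin of the end [x] of a diametral path leaves the last two vertices of
    the path undominated. *)
Lemma optimal_no_twin x : optimal -> diam G = k.+2 -> ~~ diametral_twin k x.
Proof.
move=> opt dk; apply/negP=> /andP[].
rewrite (diametral_leafE Gt) // => /eqP xd /existsP[u /andP[ux /eqP eb]].
have [y xy] := ecc_attained x; rewrite xd in xy.
have [|a xa ay] := dist_mid Gc (x := x) (y := y) (i := k.+1); first by lia.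
have ball_u z : (k < dist u z) = (k < dist x z).
  by have /setP/(_ z) := eb; rewrite !inE !ltnNge => ->.
have := @optimal_no_gain x u a y opt (@diam_simplicial _ Gt k _ _ xy) ux.
rewrite !ball_u xa xy dk.
have xu : dist x u <= k.
  by have : u \in ball k x; [rewrite eb inE dist0 | rewrite inE].
have : a != y by rewrite -(dist_eq0 Gc) ay; lia.
by move=> -> /(_ xu); lia.
Qed.

(** If [x] and [y] are twins of [u] and [w], then [u] leaves [y] and [w]
    undominated; [x] and [y] themselves are too far apart to be neighbours, as
    neighbouring simplicial vertices have the same ball. *)
Lemma optimal_no_special x y :
  optimal -> diam G = k.+1 -> ~~ special_pair k x y.
Proof.
move=> opt dk; apply/negP; rewrite /special_pair !(diametral_leafE Gt) //.
case/and5P=> /eqP xd /eqP yd /existsP[u /andP[ux /eqP eu]].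
case/existsP=> w /andP[wy /eqP ew] bxy.
have [x' xx'] := ecc_attained x; have [y' yy'] := ecc_attained y.
rewrite xd in xx'; rewrite yd in yy'.
have xs := @diam_simplicial _ Gt k _ _ xx'; have ys := @diam_simplicial _ Gt k _ _ yy'.
have xy : k < dist x y.
  by rewrite ltnNge; apply: contra bxy => xy; apply/eqP; apply: simplicial_twins.
have inball a b z : ball k a = ball k b -> (dist a z <= k) = (dist b z <= k).
  by move/setP/(_ z); rewrite !inE.
have xw : k < dist x w.
  by move: xy; rewrite !ltnNge !(dist_sym Gc x) (inball _ _ _ ew).
have yw : dist y w <= k by rewrite (inball _ _ _ ew) dist0.
have := @optimal_no_gain x u w y opt xs ux.
rewrite (inball _ _ _ eu) dist0 !(ltnNge _ (dist u _)) -!(inball _ _ _ eu) -!ltnNge.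
by move/(_ isT xw xy wy); rewrite dist_sym // ltnNge yw.
Qed.

(** The distances within [I] would all be [k.+1], but three vertices of a tree
    cannot be at pairwise odd distance. *)
Lemma indep_diam_odd I : indep (@near G k) I -> diam G = k.+1 -> #|I| <= 2.
Proof.
move=> /indep_nearP Ii dk; rewrite leqNgt; apply/negP=> /card_gt2P.
case=> x [y [z [[xI yI zI] [xy yz zx]]]].
have odd_d a b : a \in I -> b \in I -> a != b -> odd (dist a b).
  move=> aI bI ab; suff -> : dist a b = k.+1 by rewrite /= odd_double.
  by have := Ii _ _ aI bI ab; have := dist_le_diam a b; rewrite dk; lia.
have := dist_parity Gt x y z; rewrite !odd_d //.
by rewrite eq_sym.
Qed.

(** In the second alternative [I] is one vertex short, which is made up for by
    [I] not being a maximal independent set itself. *)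
Lemma split_optimal I : indep (@near G k) I ->
  {in ~: I &, forall u w, dist u w <= k} ->
  P <= #|I| \/ P <= #|I|.+1 /\
    (exists2 b, b \notin I & {in I, forall a, k < dist a b}) ->
  optimal.
Proof.
move=> Ii Ic H; rewrite /optimal num_MDISE //.
have Ic' : clique (@near G k) (~: I) by [].
apply: leq_trans (card_mis_split near_sym Ii Ic') _.
have := card_indep_le Ii; case: H => [|[le [b bI bfar]]].
  by case: (I \in _); lia.
suff -> : I \in mis (@near G k) setT = false by lia.
apply/negP=> /misP[_ _ /(_ b (in_setT b))][a aI ab].
by have := bfar a aI; rewrite ltnNge -/(near k a b) ab.
Qed.

(** Vertices at distance [k.+1] are on opposite sides of the central edge. If
    no pair is special, then one of the sides has a single diametral leaf [b],
    and all other vertices are pairwise near. *)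
Lemma no_special_optimal : diam G = k.+1 ->
  (forall x y : G, ~~ special_pair k x y) -> P <= 2 -> optimal.
Proof.
move=> dk nsp P2.
have [|x [y xy]] := @diam_attained G; first by lia.
pose opposite x := [set z | k < dist x z].
have twin_opposite a b b' : dist a b = diam G -> b' \in opposite a -> b' != b ->
    ecc b' = diam G /\ ball k b = ball k b'.
  rewrite inE => ab ab' bb'.
  have ab'd : dist a b' = diam G by have := dist_le_diam a b'; lia.
  have bs := @diam_simplicial _ Gt k _ _ (etrans (dist_sym Gc b a) ab).
  have b's := @diam_simplicial _ Gt k _ _ (etrans (dist_sym Gc b' a) ab'd).
  split.
    by apply/eqP; rewrite eqn_leq ecc_le_diam -ab'd dist_sym // dist_le_ecc.
  apply: simplicial_twins => //.
  have : odd (dist a b) && odd (dist a b') by rewrite ab ab'd dk /= odd_double.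
  have := dist_parity Gt a b b'; have := dist_le_diam b b'; rewrite dk.
  rewrite leq_eqVlt ltnS => /orP[/eqP -> |//] + /andP[o1 o2].
  by rewrite o1 o2 /= odd_double.
have single a b : dist a b = diam G -> opposite a = [set b] -> optimal.
  move=> ab oa; apply: (@split_optimal [set b]).
  - by apply/indepP=> ? ? /set1P-> /set1P->.
  - move=> u w; rewrite !inE => ub wb.
    have near_a z : z != b -> dist a z <= k.
      by apply: contraNT; rewrite -ltnNge => az; rewrite -in_set1 -oa inE.
    by apply: (simplicial_near (@diam_simplicial _ Gt k _ _ ab)); apply: near_a.
  right; rewrite cards1; split=> //; exists a.
    by rewrite inE -(dist_eq0 Gc) ab dk.
  by move=> _ /set1P->; rewrite dist_sym // ab dk.
have yx := etrans (dist_sym Gc y x) xy.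
have [e|ne] := eqVneq (opposite x) [set y]; first exact: single xy e.
have [e|ne'] := eqVneq (opposite y) [set x]; first exact: single yx e.
have other a b : dist a b = diam G -> opposite a != [set b] ->
    diametral_leaf b && twin k b.
  move=> ab oa; have [b' ob' bb'] : exists2 b', b' \in opposite a & b' != b.
    apply/exists_inP; apply: contraNT oa; rewrite negb_exists_in => /forall_inP H.
    rewrite eqEsubset sub1set inE ab dk ltnSn andbT.
    by apply/subsetP=> z /H; rewrite negbK inE.
  have [_ eb] := twin_opposite _ _ _ ab ob' bb'.
  rewrite (diametral_leafE Gt) // eqn_leq ecc_le_diam -ab dist_sym // dist_le_ecc.
  by apply/existsP; exists b'; rewrite bb' eb eqxx.
have /andP[dy ty] := other _ _ xy ne; have /andP[dx tx] := other _ _ yx ne'.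
case/negP: (nsp x y); rewrite /special_pair dx dy tx ty /=.
apply/eqP=> /setP/(_ x); rewrite !inE dist0 yx dk; lia.
Qed.

(** The diametral leaves form an independent set [A] if none is a twin, and the
    other vertices are pairwise near. The vertex [b] stands for the end of a
    leg that may be one vertex shorter than the others; if it is, then it is
    independent of [A], which is therefore not maximal. *)
Lemma no_twin_optimal : diam G = k.+2 ->
  (forall x : G, ~~ diametral_twin k x) ->
  (exists2 I : {set G}, #|I| = P & indep (@near G k) I /\
     exists b, {in I :\ b, forall x, ecc x = diam G}) -> optimal.
Proof.
move=> dk ntw [I cI [/indep_nearP Ii [b bI]]].
pose A := [set x : G | ecc x == diam G].
have Ai : indep (@near G k) A.
  apply/indep_nearP=> x y; rewrite !inE => /eqP xd /eqP yd xy.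
  rewrite ltnNge; apply/negP=> xyk; have := ntw x.
  rewrite /diametral_twin (diametral_leafE Gt) // xd eqxx /=.
  case/existsP; exists y; rewrite eq_sym xy /=.
  have [x' xx'] := ecc_attained x; have [y' yy'] := ecc_attained y.
  rewrite xd in xx'; rewrite yd in yy'.
  by rewrite (@simplicial_twins _ Gt k x y) //; apply: diam_simplicial; eassumption.
apply: (split_optimal Ai).
  have [|x [y xy]] := @diam_attained G; first by lia.
  move=> u w; rewrite !inE => uA wA.
  have small z z' : ecc z != diam G -> dist z z' <= k.+1.
    move=> zd; rewrite -ltnS -dk; apply: leq_ltn_trans (dist_le_ecc z z') _.
    by rewrite ltn_neqAle zd ecc_le_diam.
  have := four_point Gt u w x y; rewrite xy dk.
  have := small _ x uA; have := small _ y uA; have := small _ x wA.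
  by have := small _ y wA; lia.
have sub : I :\ b \subset A by apply/subsetP=> x /bI xd; rewrite inE xd.
have cA := subset_leq_card sub.
have [bA|bA] := boolP (b \in A).
  left; rewrite -cI; apply: subset_leq_card; apply/subsetP=> x xI.
  by have [->//|xb] := eqVneq x b; apply: (subsetP sub); rewrite !inE xb.
have PA1 : P <= #|A|.+1 by rewrite -cI (cardsD1 b I); case: (b \in I); lia.
have [AP|] := ltnP #|A| P; last by left.
have PA : P = #|A|.+1 by apply/eqP; rewrite eqn_leq PA1.
right; split; first exact: PA1.
exists b; first exact: bA.
move=> a aA.
have AI : I :\ b = A.
  by apply/eqP; rewrite eqEcard sub /= -ltnS -PA -cI (cardsD1 b I); case: (b \in I); lia.
have bI' : b \in I.
  apply: contraT => bI'; move: cI cA.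
  by rewrite (cardsD1 b I) (negbTE bI') AI PA; lia.
by move: aA; rewrite -AI !inE => /andP[ab aI]; apply: Ii.
Qed.

End Optimal.

(** * Paths, truncated spiders and an extremal tree *)

Section PathCoordinates.

Variable m : nat.

Definition path_coord (i : path_graph m.+1) : option (nat * nat) :=
  if val i is a.+1 then Some (0, a) else None.

Lemma path_coord_inj : injective path_coord.
Proof. by move=> [[|i] ?] [[|j] ?] //= => [_|[ij]]; apply: val_inj => /=; rewrite ?ij. Qed.

Lemma path_coord_adj i j : adj i j = leg_adj (path_coord i) (path_coord j).
Proof. by case: i j => [[|i] ?] [[|j] ?]; rewrite /= /path_adj /consecutive /=; lia. Qed.

Lemma path_coord_down x i a :
  path_coord x = Some (i, a.+1) -> exists y, path_coord y = Some (i, a).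
Proof.
case: x => [[|b] bm] //= [<- eb].
have am : a.+1 < m.+1 by lia.
by exists (Ordinal am).
Qed.

Lemma path_tree : is_tree (path_graph m.+1).
Proof.
exact: (@sub_spider_tree (path_graph m.+1) path_coord ord0 path_coord_inj path_coord_adj erefl
  path_coord_down).
Qed.

Lemma diam_path : diam (path_graph m.+1) = m.
Proof.
have [_ Pc _] := path_tree; apply/eqP; rewrite eqn_leq; apply/andP; split.
  by apply: diam_le => x y; have := dist_lt_card Pc x y; rewrite card_ord ltnS.
have [-> //|m0] := posnP m.
have em : path_coord ord_max = Some (0, m.-1).
  by rewrite /path_coord /=; case: (m) m0.
apply: leq_trans (dist_le_diam (ord_max : path_graph m.+1) ord0).
have := @depth_le_dist (path_graph m.+1) _ ord0 path_coord_inj path_coord_adj erefl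
  path_coord_down ord_max ord0.
by rewrite em /= prednK // addn0; apply.
Qed.

End PathCoordinates.

Section SpiderMinusLeaf.

Variables (p s : nat) (v : spider p s.+1).
Hypotheses (p_gt2 : 2 < p) (s_gt0 : 0 < s) (v_leaf : leaf v).

Lemma spider_leaf : exists i : 'I_p, v = Some (i, ord_max).
Proof.
have two (a b : spider p s.+1) : adj v a -> adj v b -> a = b.
  move=> va vb; apply/eqP; have /cards1P[z ez] := v_leaf.
  have az : a \in [set y | adj v y] by rewrite inE.
  have bz : b \in [set y | adj v y] by rewrite inE.
  by move: az bz; rewrite ez => /set1P-> /set1P->.
case ev : v => [[i a]|].
  exists i; congr (Some (_, _)); apply: val_inj => /=; apply/eqP.
  rewrite eqn_leq -ltnS ltn_ord leqNgt; apply/negP=> ai.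
  have a1 : a.+1 < s.+1 by [].
  have up : adj v (Some (i, Ordinal a1) : spider p s.+1).
    by rewrite ev /= eqxx /consecutive /= eqxx.
  case ea : (val a) => [|b].
    have dn : adj v (None : spider p s.+1) by rewrite ev /= ea.
    by have := two _ _ dn up.
  have bs : b < s.+1.
    by have := ltn_ord a; rewrite -[nat_of_ord a]/(val a) ea; apply: ltnW.
  have dn : adj v (Some (i, Ordinal bs) : spider p s.+1).
    by rewrite ev /= eqxx /consecutive /= ea eqxx orbT.
  by case: (two _ _ dn up) => e; move: ea; rewrite /=; lia.
have p0 : 0 < p by lia.
have p1 : 1 < p by lia.
have := two (Some (Ordinal p0, ord0)) (Some (Ordinal p1, ord0)).
by rewrite ev /= => /(_ isT isT).
Qed.

Notation T := (delete_vertex v).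

Definition spider_coord (x : T) : option (nat * nat) :=
  if val x is Some (i, a) then Some (val i, val a) else None.

Lemma spider_coord_inj : injective spider_coord.
Proof.
move=> [x xv] [y yv]; rewrite /spider_coord /= => xy; apply: val_inj => /=.
case: x y xy {xv yv} => [[i a]|] [[j b]|] //= [ij ab].
by congr (Some (_, _)); apply: val_inj.
Qed.

Lemma spider_coord_adj x y : adj x y = leg_adj (spider_coord x) (spider_coord y).
Proof.
case: x y => [[[i a]|] xv] [[[j b]|] yv] //=; rewrite /delete_adj //=.
Qed.

Lemma spider_coord_ltn x i a : spider_coord x = Some (i, a) -> i < p /\ a < s.+1.
Proof. by case: x => [[[j b]|] xv] //= [<- <-]. Qed.

Lemma spider_coord_ex i a (ip : i < p) (a_s : a < s.+1) :
  v != Some (Ordinal ip, Ordinal a_s) -> exists x : T, spider_coord x = Some (i, a).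
Proof. rewrite eq_sym => xv.
by exists (exist (fun x : spider p s.+1 => is_true (x != v)) _ xv). Qed.

Lemma spider_coord_down x i a :
  spider_coord x = Some (i, a.+1) -> exists y, spider_coord y = Some (i, a).
Proof.
case/spider_coord_ltn=> ip a_s; have a_s' : a < s.+1 by apply: ltnW.
apply: (@spider_coord_ex i a ip a_s'); have [j ->] := spider_leaf.
by apply/eqP=> -[_ e]; lia.
Qed.

Lemma spider_centre : exists c : T, spider_coord c = None.
Proof.
have cv : None != v by have [i ->] := spider_leaf.
by exists (exist (fun x : spider p s.+1 => is_true (x != v)) None cv).
Qed.

Lemma spider_minus_leaf_tree : is_tree T.
Proof.
have [c ec] := spider_centre.
exact: sub_spider_tree spider_coord_inj spider_coord_adj ec spider_coord_down.
Qed.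

Lemma card_spider_minus_leaf : #|T| = p * s.+1.
Proof.
rewrite card_sig; have := cardC1 v; rewrite card_option card_prod !card_ord /= => <-.
by apply: eq_card => x; rewrite !inE.
Qed.

(** [w] chooses the ends of the legs, and [i0] is the leg that has lost its last
    vertex. *)
Lemma spider_ends : exists (i0 : 'I_p) (w : 'I_p -> T),
  (forall i j, i != j -> s.*2 < dist (w i) (w j)) /\
  (forall i j, i != i0 -> j != i0 -> i != j -> s.*2.+2 <= dist (w i) (w j)).
Proof.
have [c ec] := spider_centre; have [i0 ev] := spider_leaf.
pose h (i : 'I_p) := if i == i0 then s.-1 else s.
have hs i : h i < s.+1 by rewrite /h; case: ifP; lia.
have ex i : exists x : T, spider_coord x == Some (val i, h i).
  have [|x ex] := @spider_coord_ex (val i) (h i) (ltn_ord i) (hs i).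
    rewrite ev; apply/eqP=> -[e1]; have -> : i = i0 by apply: val_inj; rewrite e1.
    by rewrite /h eqxx; lia.
  by exists x; rewrite ex.
have dw i j : i != j -> (h i).+1 + (h j).+1 <= dist (xchoose (ex i)) (xchoose (ex j)).
  move=> ij; have /eqP ei := xchooseP (ex i); have /eqP ej := xchooseP (ex j).
  have := @depth_le_dist _ _ _ spider_coord_inj spider_coord_adj ec spider_coord_down
    (xchoose (ex i)) (xchoose (ex j)).
  rewrite ei ej /=; apply; apply: contra ij => /eqP[e]; apply/eqP; exact: val_inj.
exists i0, (fun i => xchoose (ex i)); split=> i j.
  move=> ij; apply: leq_trans (dw _ _ ij); rewrite /h.
  have [ei|_] := eqVneq i i0; have [ej|_] := eqVneq j i0; try lia.
  by rewrite ei ej eqxx in ij.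
move=> /negbTE i_i0 /negbTE j_i0 ij; apply: leq_trans (dw _ _ ij).
rewrite /h i_i0 j_i0; lia.
Qed.

Lemma diam_spider_minus_leaf : diam T = s.*2.+2.
Proof.
have [c ec] := spider_centre.
have dle := dist_le_depth spider_coord_inj spider_coord_adj ec spider_coord_down.
apply/eqP; rewrite eqn_leq; apply/andP; split.
  apply: diam_le => x y; apply: leq_trans (dle x y) _.
  have hs z : depth (spider_coord z) <= s.+1.
    by case e : (spider_coord z) => [[i a]|] //=; case/spider_coord_ltn: e.
  by have := leq_add (hs x) (hs y); lia.
have [i0 [w [_ wd]]] := spider_ends.
have : 1 < #|[set~ i0]| by rewrite cardsC1 card_ord; lia.
case/card_gt1P=> i [j []]; rewrite !inE => ii ji ij.
exact: leq_trans (wd i j ii ji ij) (dist_le_diam _ _).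
Qed.

End SpiderMinusLeaf.

Section Extremal.

(** The spider filled leg after leg, each of length [s.+1], until it has
    [n.+1] vertices. *)
Variables (s n : nat).

Definition fill_coord (x : 'I_n.+1) : option (nat * nat) :=
  if val x is y.+1 then Some (y %/ s.+1, y %% s.+1) else None.

Lemma leg_adj_sym : symmetric leg_adj.
Proof.
by move=> [[i a]|] [[j b]|] //=; rewrite eq_sym consecutive_sym.
Qed.

Lemma leg_adj_irr : irreflexive leg_adj.
Proof. by move=> [[i a]|] //=; rewrite consecutive_irr andbF. Qed.

Definition fill_adj (x y : 'I_n.+1) := leg_adj (fill_coord x) (fill_coord y).

Lemma fill_adj_sym : symmetric fill_adj.
Proof. by move=> x y; apply: leg_adj_sym. Qed.

Lemma fill_adj_irr : irreflexive fill_adj.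
Proof. by move=> x; apply: leg_adj_irr. Qed.

Definition filled_spider : graph := Graph fill_adj_sym fill_adj_irr.

Lemma fill_coord_inj : injective fill_coord.
Proof.
move=> [[|x] xn] [[|y] yn] //= => [_|[xq xr]]; apply: val_inj => //=.
by rewrite (divn_eq x s.+1) (divn_eq y s.+1) xq xr.
Qed.

Lemma fill_coord_down x i a :
  fill_coord x = Some (i, a.+1) -> exists y, fill_coord y = Some (i, a).
Proof.
case: x => [[|x] xn] //= [xq xr].
have ex := divn_eq x s.+1; rewrite xq xr in ex.
have yn : (i * s.+1 + a).+1 < n.+1 by lia.
have a_s : a < s.+1 by have := ltn_pmod x (ltn0Sn s); rewrite xr; lia.
exists (Ordinal yn); rewrite /fill_coord /= divnMDl // modnMDl.
by rewrite (divn_small a_s) (modn_small a_s) addn0.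
Qed.

Lemma filled_spider_tree : is_tree filled_spider.
Proof.
exact: (@sub_spider_tree filled_spider fill_coord ord0 fill_coord_inj
  (fun _ _ => erefl) erefl
    fill_coord_down).
Qed.

(** The vertices of depth [s.+1] are independent and the others pairwise near.
    If [s.+1] divides the order, then the last leg is one vertex short and its
    end shows that this independent set is not maximal. *)
Lemma filled_spider_optimal :
  0 < s -> s.*2 + 2 <= n.+1 -> optimal filled_spider s.
Proof.
move=> s0 sn; pose H := filled_spider.
have card_H : #|H| = n.+1 by rewrite card_ord.
pose d (x : H) := depth (fill_coord x).
have dle (x y : H) : dist x y <= d x + d y.
  exact: (@dist_le_depth H fill_coord ord0 fill_coord_inj (fun _ _ => erefl) erefl
    fill_coord_down).
have dge (x y : H) : leg (fill_coord x) != leg (fill_coord y) -> d x + d y <= dist x y.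
  exact: (@depth_le_dist H fill_coord ord0 fill_coord_inj (fun _ _ => erefl) erefl
    fill_coord_down).
have d_le (x : H) : d x <= s.+1.
  by rewrite /d /fill_coord; case: (val x) => [//|y] /=; rewrite ltn_mod.
pose A := [set x : H | d x == s.+1].
have same_leg (x y : H) : 0 < d x -> d x = d y ->
    leg (fill_coord x) = leg (fill_coord y) -> x = y.
  rewrite /d => dx dxy lxy; apply: fill_coord_inj; move: dx dxy lxy.
  by case: (fill_coord x) (fill_coord y) => [[i a]|] [[j b]|] //= _ [->] [->].
have Ai : indep (near s.*2) A.
  apply/indep_nearP=> x y; rewrite !inE => /eqP dx /eqP dy xy.
  apply: leq_trans (dge x y _); first by rewrite dx dy; lia.
  by apply: contra xy => /eqP e; rewrite (same_leg x y) ?dx ?dy.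
have Ac : {in ~: A &, forall x y, dist x y <= s.*2}.
  move=> x y; rewrite !inE => xA yA; apply: leq_trans (dle x y) _.
  by have := d_le x; have := d_le y; lia.
have cA q : q * s.+1 < n.+1 -> q <= #|A|.
  move=> qn; have iq (t : 'I_q) : t.+1 * s.+1 < n.+1.
    by apply: leq_ltn_trans qn; rewrite leq_mul2r ltn_ord orbT.
  pose f (t : 'I_q) : H := Ordinal (iq t).
  have fi : injective f.
    move=> t t' /(congr1 val) /eqP; rewrite /= (eqn_pmul2r (ltn0Sn s)) eqSS.
    by move/eqP; apply: val_inj.
  rewrite -{1}(card_ord q) -(card_imset _ fi); apply: subset_leq_card.
  apply/subsetP=> _ /imsetP[t _ ->]; rewrite inE /d /fill_coord.
  have -> : val (f t) = (t * s.+1 + s).+1 by rewrite /= mulSn; lia.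
  by rewrite /= modnMDl modn_small.
apply: (split_optimal filled_spider_tree s0 _ Ai Ac); first by rewrite card_H.
rewrite card_H; set P := n.+1 %/ s.+1.
have [lt|ge] := ltnP (P * s.+1) n.+1; [by left; apply: cA | right].
have eP : n.+1 = P * s.+1 by apply/eqP; rewrite eqn_leq ge leq_trunc_div.
have P2 : 1 < P by rewrite leq_divRL //; lia.
have en : n = P.-1 * s.+1 + s.
  by have := eP; rewrite -{1}(ltn_predK P2) mulSn; lia.
split.
  rewrite -(ltn_predK P2) ltnS; apply: cA.
  by rewrite [X in _ < X.+1]en ltnS leq_addr.
have db : d ord_max = s.
  rewrite /d /fill_coord /= en; case: (s) s0 => [//|s'] _.
  by rewrite addnS modnMDl /= modn_small.
have lb : leg (fill_coord ord_max) = Some P.-1.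
  rewrite /fill_coord /= en; case: (s) s0 => [//|s'] _.
  by rewrite addnS divnMDl // divn_small // addn0.
exists ord_max; first by rewrite inE db; lia.
move=> a; rewrite inE => /eqP da; apply: leq_trans (dge a ord_max _).
  by rewrite da db; lia.
rewrite lb; apply/eqP; move: da; rewrite /d /fill_coord.
case: a => [[|y] yn] //= [yr] [yq].
by have := divn_eq y s.+1; rewrite yq yr -en => ey; rewrite ey ltnn in yn.
Qed.

End Extremal.

(** * Embeddings into a tree *)

Section Embeddings.

Variable G : graph.
Hypothesis Gt : is_tree G.
Implicit Types (x y c w : G) (I : {set G}).

Let Gc : connected G. Proof. by case: Gt. Qed.

Lemma contains_geodesic x y : contains_subgraph G (path_graph (dist x y).+1).
Proof.
have [p [pp lst sz]] := geodesic Gc x y; rewrite -sz.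
exists (fun i : path_graph (size p).+1 => nth x (x :: p) i).
  move=> i j ij; apply: val_inj => /=.
  have d (l : 'I_(size p).+1) : dist x (nth x (x :: p) l) = l.
    by case: (geodesic_nth Gc pp _ (ltn_ord l)) => //; rewrite lst.
  by rewrite -(d i) ij d.
suff step (i j : 'I_(size p).+1) : val j = (val i).+1 ->
    adj (nth x (x :: p) i) (nth x (x :: p) j).
  by move=> i j /orP[] /eqP e; [exact: step | rewrite adj_sym; exact: step].
move=> ij; move/(pathP x): pp => /(_ (val i)); rewrite ij; apply.
by rewrite -ltnS -ij ltn_ord.
Qed.

(** Injective homomorphisms preserve paths, and paths of a tree are
    geodesics. *)
Lemma embedding_dist (T : graph) (f : T -> G) : connected T -> injective f ->
  (forall x y : T, adj x y -> adj (f x) (f y)) ->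
  forall a b, dist (f a) (f b) = dist a b.
Proof.
move=> Tc fi fadj a b; have [p [pp lst sz]] := geodesic Tc a b.
rewrite -sz -lst -last_map.
rewrite uniq_path_geodesic ?size_map //.
  by rewrite path_map; apply: sub_path pp => x y; apply: fadj.
by rewrite -map_cons map_inj_uniq // (geodesic_uniq Tc) // lst.
Qed.

(** Two vertices at distance more than [s.*2] have depths that sum to more than
    [s.*2], so at most one of them has depth [s] instead of [s.+1]. *)
Lemma independent_legs s c I : (forall x, dist c x <= s.+1) ->
  indep (near s.*2) I -> 1 < #|I| -> exists2 w0, w0 \in I &
  s <= dist c w0 /\ {in I, forall w, w != w0 -> dist c w = s.+1}.
Proof.
move=> cs /indep_nearP Ii I1.
have sum x y : x \in I -> y \in I -> x != y -> s.*2 < dist c x + dist c y.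
  move=> xI yI xy; apply: leq_trans (Ii _ _ xI yI xy) _.
  by rewrite (dist_sym Gc c x) dist_tri.
have /card_gt1P[x [y [xI yI xy]]] := I1.
have [w0 w0I w0min] := arg_minnP (P := mem I) (dist c) xI.
exists w0 => //; split.
  by have := sum _ _ xI yI xy; have := cs x; have := cs y;
    have := w0min x xI; have := w0min y yI;
    have [->|xw] := eqVneq x w0; [ | have := sum _ _ xI w0I xw]; lia.
move=> w wI ww; have := sum _ _ wI w0I ww; have := w0min w wI; have := cs w; lia.
Qed.

(** The geodesics from the centre [c] to the vertices of [I] share only [c], as
    otherwise two vertices of [I] would be within [s.*2] of each other. The leg
    that lacks [v] is sent to the shortest of these geodesics. *)
Lemma contains_spider_minus_leaf s p (v : spider p s.+1) I : leaf v ->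
  2 < p -> 0 < s -> diam G = s.*2.+2 -> indep (near s.*2) I -> #|I| = p ->
  contains_subgraph G (delete_vertex v).
Proof.
move=> vl p2 s0 dk Ii cI; have [i0 ev] := spider_leaf p2 s0 vl.
have [|x [y xy]] := @diam_attained G; first by case: Gt.
have [|c xc cy] := dist_mid Gc (x := x) (y := y) (i := s.+1); first by lia.
have cs z : dist c z <= s.+1.
  by have := four_point Gt z c x y; have := dist_le_diam z x;
    have := dist_le_diam z y; rewrite (dist_sym Gc c x) (dist_sym Gc c z); lia.
have [|w0 w0I [w0s wI]] := independent_legs cs Ii; first by rewrite cI; lia.
have /indep_nearP Ii' := Ii.
pose g (i : 'I_p) := enum_val (cast_ord (esym cI) i).
pose i1 := cast_ord cI (enum_rank_in w0I w0).
(* The transposition puts [w0] at the end of the shortened leg. *)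
pose w i := g (tperm i0 i1 i).
have w_in i : w i \in I by apply: enum_valP.
have w_inj : injective w.
  by move=> i j /enum_val_inj /cast_ord_inj /perm_inj.
have w_i0 : w i0 = w0 by rewrite /w tpermL /g /i1 cast_ordK enum_rankK_in.
have /fin_all_exists[q qP] i := geodesic Gc c (w i).
have q_nth i a : a <= dist c (w i) ->
    dist c (nth c (c :: q i) a) = a /\
    dist (nth c (c :: q i) a) (w i) = dist c (w i) - a.
  have [pp lst sz] := qP i; rewrite -sz => le.
  by have [] := geodesic_nth Gc pp _ le; rewrite lst.
have on_leg i (a : 'I_s.+1) : Some (i, a) != v -> a < dist c (w i).
  rewrite ev => ne; have [ei|ni] := eqVneq i i0.
    rewrite ei w_i0; apply: leq_trans w0s; rewrite ltn_neqAle -ltnS ltn_ord andbT.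
    apply: contra ne => /eqP e; rewrite ei; apply/eqP; congr (Some (_, _)).
    exact: val_inj.
  by rewrite wI // -w_i0 (inj_eq w_inj).
pose f (z : delete_vertex v) :=
  if val z is Some (i, a) then nth c (c :: q i) a.+1 else c.
exists f; rewrite /f.
  move=> [[[i a]|] xv] [[[j b]|] yv] /= fxy; apply: val_inj => //=.
  - have [da wa] := q_nth i a.+1 (on_leg i a xv).
    have [db wb] := q_nth j b.+1 (on_leg j b yv).
    rewrite -[nth c (c :: q j) b.+1]fxy in db wb.
    rewrite -[nth c (q i) a]/(nth c (c :: q i) a.+1) in db wb.
    have ab : a = b by apply: val_inj; apply: succn_inj; rewrite -da -db.
    have [->|ij] := eqVneq i j; first by rewrite ab.
    have := Ii' _ _ (w_in i) (w_in j); rewrite (inj_eq w_inj) => /(_ ij).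
    have := dist_tri Gc (nth c (c :: q i) a.+1) (w i) (w j).
    rewrite (dist_sym Gc (w i) (nth _ _ _)) wa wb.
    by have := cs (w i); have := cs (w j); lia.
  - have [] := q_nth i a.+1 (on_leg i a xv).
    by rewrite /= fxy dist0.
  - have [] := q_nth j b.+1 (on_leg j b yv).
    by rewrite /= -fxy dist0.
have q_adj i a : a < dist c (w i) ->
    adj (nth c (c :: q i) a) (nth c (c :: q i) a.+1).
  by have [/(pathP c) pp _ <-] := qP i; apply: pp.
move=> [[[i a]|] xv] [[[j b]|] yv] //=; rewrite /delete_adj /=.
- case/andP=> /eqP ij /orP[] /eqP e.
    rewrite e -ij; apply: (q_adj i a.+1); rewrite -e ij; exact: on_leg yv.
  by rewrite adj_sym e ij; apply: (q_adj j b.+1); rewrite -e -ij; exact: on_leg xv.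
- move=> /eqP e; rewrite e adj_sym; apply: (q_adj i 0).
  exact: leq_ltn_trans (on_leg _ _ xv).
- move=> /eqP e; rewrite e; apply: (q_adj j 0).
  exact: leq_ltn_trans (on_leg _ _ yv).
Qed.

End Embeddings.

(** * Minimal trees *)

Lemma fk_double s n :
  fk s.*2 n = if n <= s.*2 + 1 then n else n - n %/ s.+1 + 1.
Proof. by rewrite /fk modn2 odd_double subn0 divn2 doubleK [s + 1]addn1. Qed.

Lemma small_num_MDIS (G : graph) k :
  is_tree G -> #|G| <= k + 1 -> num_MDIS G k = #|G|.
Proof.
move=> Gt Gk; have [G0 Gc _] := Gt.
have dk (x y : G) : dist x y <= k by have := @dist_lt_card G Gc x y; lia.
have near_sym : symmetric (@near G k) by move=> x y; rewrite /near dist_sym.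
apply/eqP; rewrite eqn_leq; apply/andP; split.
  rewrite num_MDISE //.
  have i0 : indep (@near G k) set0 by apply/indepP=> x y; rewrite in_set0.
  have c0 : clique (@near G k) (~: set0) by move=> x y _ _; apply: dk.
  apply: leq_trans (card_mis_split near_sym i0 c0) _.
  rewrite cards0 subn0; suff -> : set0 \in mis (@near G k) setT = false by rewrite addn0.
  apply/negP=> /misP[_ _ H]; have /card_gt0P[x _] := G0.
  by have [u] := H x (in_setT x); rewrite in_set0.
have [I /indep_nearP Ii] := card_near_mis Gt k.
have : #|I| <= 1; last by lia.
apply/card_le1_eqP=> x y xI yI; apply/eqP/negPn/negP=> xy.
by have := Ii _ _ yI xI xy; rewrite ltnNge dk.
Qed.

Section Minimal.

Variables (s n : nat).
Hypotheses (s_gt0 : 0 < s) (sn : s.*2 + 2 <= n).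

Notation k := s.*2.
Notation P := (n %/ s.+1).

(** The filled spider attains the lower bound, whatever the order. *)
Lemma minimal_optimal (G : graph) :
  minimal_tree k n G <-> [/\ is_tree G, #|G| = n & optimal G s].
Proof.
have nS : n = n.-1.+1 by lia.
split=> [[Gt Gn Gmin]|[Gt Gn opt]]; split=> //.
  have Hn : #|filled_spider s n.-1| = n by rewrite card_ord -nS.
  have := Gmin _ (filled_spider_tree s n.-1) Hn.
  have := @filled_spider_optimal s n.-1 s_gt0; rewrite -nS /optimal Hn Gn.
  by move=> /(_ sn) le /leq_trans; apply.
move=> H Ht Hn; have := @num_MDIS_ge H s Ht s_gt0; rewrite Hn => /(_ sn).
by apply: leq_trans; move: opt; rewrite /optimal Gn.
Qed.

Lemma minimal_num_MDIS (G : graph) :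
  minimal_tree k n G -> num_MDIS G k = n - P + 1.
Proof.
case/minimal_optimal=> Gt Gn opt.
have := @num_MDIS_ge G s Gt s_gt0; move: opt; rewrite /optimal Gn.
by move=> le /(_ sn) ge; apply/eqP; rewrite eqn_leq le.
Qed.

Lemma minimal_path (G : graph) : n = k + 2 ->
  minimal_tree k n G <-> isomorphic G (path_graph (k + 2)).
Proof.
move=> nk; rewrite minimal_optimal addn2; split.
  case=> Gt Gn opt; have [_ Gc _] := Gt.
  have kd := optimal_diam_gt Gt s_gt0 (eq_leq (etrans (esym nk) (esym Gn))) opt.
  have [|x [y xy]] := @diam_attained G; first by case: Gt.
  have dxy : dist x y = k.+1.
    by rewrite xy; apply/eqP; rewrite eqn_leq kd andbT -xy;
      have := dist_lt_card Gc x y; lia.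
  have [f fi fadj] := contains_geodesic Gt x y; rewrite dxy in f fi fadj.
  have fb : bijective f.
    by apply: inj_card_bij fi _; rewrite Gn card_ord nk addn2.
  have [g fK gK] := fb; exists g; first by exists f.
  have [_ Pc _] := path_tree k.+1.
  have fd := embedding_dist Gt Pc fi fadj.
  move=> a b; apply/idP/idP => [/fadj|ab]; first by rewrite !gK.
  by apply: dist1_adj => //; rewrite -fd !gK; apply: adj_dist1.
case=> f fb fadj; have fi := bij_inj fb; have [g fK gK] := fb.
(* The set of the end [x] of the path is independent, and all other vertices
   are within [k] of the other end [g ord0], which is simplicial. *)
pose phi x := path_coord (f x).
have phi_inj : injective phi by move=> x y /path_coord_inj /fi.
have phi_adj x y : adj x y = leg_adj (phi x) (phi y) by rewrite -fadj path_coord_adj.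
have phi_c : phi (g ord0) = None by rewrite /phi gK.
have phi_down x i a : phi x = Some (i, a.+1) -> exists y, phi y = Some (i, a).
  by case/path_coord_down=> y ey; exists (g y); rewrite /phi gK.
have Gt := sub_spider_tree phi_inj phi_adj phi_c phi_down.
have [_ Gc _] := Gt.
have Gn : #|G| = n by rewrite (bij_eq_card fb) card_ord nk addn2.
have depthE u : depth (phi u) = val (f u).
  by rewrite /phi /path_coord; case: (val (f u)).
pose x := g ord_max.
have far_x : k < dist x (g ord0).
  have := depth_le_dist phi_inj phi_adj phi_c phi_down (x := x) (y := g ord0).
  by rewrite !depthE /x !gK /= addn0 /phi !gK; apply.
have xd : dist (g ord0) x = diam G.
  apply/eqP; rewrite eqn_leq dist_le_diam /=; rewrite dist_sym //.
  apply: leq_trans far_x.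
  by apply: diam_le => a b; have := dist_lt_card Gc a b; rewrite Gn; lia.
split=> //; apply: (@split_optimal G s Gt s_gt0 _ [set x]).
- by rewrite Gn.
- by apply/indepP=> a b /set1P-> /set1P->.
- have near_end u : u \notin [set x] -> dist (g ord0) u <= k.
    rewrite inE => ux; rewrite dist_sym //.
    apply: leq_trans (dist_centre phi_inj phi_adj phi_c phi_down u) _.
    rewrite depthE -ltnS ltn_neqAle -ltnS ltn_ord andbT.
    apply: contra ux => /eqP e; apply/eqP; rewrite /x -(fK u); congr g.
    exact: val_inj.
  move=> u w; rewrite inE => /near_end gu; rewrite inE => /near_end gw.
  exact: (simplicial_near (@diam_simplicial _ Gt k _ _ xd)).
right; rewrite cards1 Gn nk; split.
  by rewrite -ltnS ltn_divLR //; lia.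
exists (g ord0); last by move=> _ /set1P->.
by rewrite inE -(dist_eq0 Gc) dist_sym // -lt0n; apply: leq_trans far_x.
Qed.

Lemma P_gt1 : 1 < P. Proof. by rewrite leq_divRL //; lia. Qed.

Lemma minimal_middle (G : graph) : k + 3 <= n -> n <= (s * 3) + 2 ->
  minimal_tree k n G <->
    Add_star k (path_graph (k + 2)) (n - k - 2) G \/
    Add k (path_graph (k + 3)) (n - k - 3) G.
Proof.
move=> kn n3; have P2 : P = 2.
  by apply/eqP; rewrite eqn_leq P_gt1 andbT -ltnS ltn_divLR //; lia.
rewrite minimal_optimal addn2 addn3; split.
  case=> Gt Gn opt; have kG : k + 2 <= #|G| by rewrite Gn; lia.
  have kd := optimal_diam_gt Gt s_gt0 kG opt.
  have dk := optimal_diam_le Gt s_gt0 kG opt.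
  have [|x [y xy]] := @diam_attained G; first by case: Gt.
  have := contains_geodesic Gt x y; rewrite xy.
  move: dk; rewrite leq_eqVlt => /orP[/eqP dk|dk].
    rewrite dk => sub; right; split=> //; last by move=> z; apply: optimal_no_twin.
      by rewrite card_ord Gn; lia.
    by rewrite diam_path.
  have {}dk : diam G = k.+1 by apply/eqP; rewrite eqn_leq kd andbT -ltnS.
  rewrite dk => sub; left; split=> //; last by move=> z t; apply: optimal_no_special.
    by rewrite card_ord Gn; lia.
  by rewrite diam_path.
case=> -[Gt]; rewrite card_ord diam_path => Gn dk _ H.
  have {}Gn : #|G| = n by rewrite Gn; lia.
  by split=> //; apply: no_special_optimal => //; rewrite Gn ?P2 //; lia.
have {}Gn : #|G| = n by rewrite Gn; lia.
split=> //; apply: no_twin_optimal => //; first by rewrite Gn; lia.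
have [_ Gc _] := Gt.
have [|x [y xy]] := @diam_attained G; first by case: Gt.
have xny : x != y by rewrite -(dist_eq0 Gc) xy dk.
have yx : dist y x = diam G by rewrite dist_sym.
exists [set x; y]; first by rewrite cards2 xny Gn P2.
split.
  by apply/indep_nearP=> a b; rewrite !inE => /orP[] /eqP-> /orP[] /eqP->;
    rewrite ?eqxx // (xy, yx) dk.
exists y => z; rewrite !inE => /andP[/negbTE->]; rewrite orbF => /eqP->.
by apply/eqP; rewrite eqn_leq ecc_le_diam -xy dist_le_ecc.
Qed.

Lemma minimal_large (G : graph) (v : spider P s.+1) : leaf v ->
  (s * 3) + 3 <= n ->
  minimal_tree k n G <-> Add k (delete_vertex v) (n %% s.+1) G.
Proof.
move=> vl n3; have P3 : 2 < P by rewrite leq_divRL //; lia.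
have nE := divn_eq n s.+1.
rewrite minimal_optimal; split.
  case=> Gt Gn opt; have kG : k + 2 <= #|G| by rewrite Gn; lia.
  have [I Ii] := optimal_indep Gt s_gt0 kG opt; rewrite Gn => cI.
  have kd := optimal_diam_gt Gt s_gt0 kG opt.
  have := optimal_diam_le Gt s_gt0 kG opt; rewrite leq_eqVlt => /orP[/eqP dk|dk].
    split=> //.
    - by rewrite card_spider_minus_leaf -?nE.
    - by rewrite diam_spider_minus_leaf.
    - exact: (contains_spider_minus_leaf Gt (I := I)).
    - by move=> x; apply: optimal_no_twin.
  have := indep_diam_odd Gt s_gt0 kG Ii; rewrite cI leqNgt P3 => /(_ _)/notF[].
  by apply/eqP; rewrite eqn_leq kd andbT -ltnS.
case=> Gt; rewrite card_spider_minus_leaf // -nE diam_spider_minus_leaf //.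
move=> Gn dk [f fi fadj] ntw; split=> //.
have [_ Gc _] := Gt.
have [_ Tc _] := spider_minus_leaf_tree P3 s_gt0 vl.
have [i0 [w [wd we]]] := spider_ends P3 s_gt0 vl.
have fd := embedding_dist Gt Tc fi fadj.
have winj : injective w.
  move=> i j ij; apply/eqP/negPn/negP=> ne.
  by have := wd i j ne; rewrite ij dist0.
apply: no_twin_optimal => //; first by rewrite Gn; lia.
exists [set f (w i) | i : 'I_P].
  by rewrite card_imset ?card_ord ?Gn // => i j /fi /winj.
split.
  apply/indep_nearP=> _ _ /imsetP[i _ ->] /imsetP[j _ ->] ij.
  by rewrite fd wd //; apply: contraNneq ij => ->.
exists (f (w i0)) => x; rewrite !inE => /andP[xi /imsetP[i _ ex]].
have ii : i != i0 by apply: contraNneq xi => <-; rewrite ex.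
have /card_gt0P[j] : 0 < #|~: [set i; i0]|.
  by have := cardsC [set i; i0]; rewrite cards2 card_ord; case: (_ != _); lia.
rewrite !inE negb_or => /andP[ji ji0].
apply/eqP; rewrite eqn_leq ecc_le_diam dk ex.
apply: leq_trans (dist_le_ecc _ (f (w j))).
by rewrite fd we // eq_sym.
Qed.

End Minimal.

Theorem theorem1 (k n : nat) (hk2 : 2 <= k) (hk : ~~ odd k) (hn : 1 <= n) :
  (forall G : graph, minimal_tree k n G -> num_MDIS G k = fk k n)
  /\ (n <= k + 1 ->
      forall G : graph, is_tree G -> #|G| = n -> minimal_tree k n G)
  /\ (n = k + 2 ->
      forall G : graph, minimal_tree k n G <-> isomorphic G (path_graph (k + 2)))
  /\ (k + 3 <= n -> n <= (3 * k) %/ 2 + 2 ->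
      forall G : graph,
        minimal_tree k n G <->
        Add_star k (path_graph (k + 2)) (n - k - 2) G
        \/ Add k (path_graph (k + 3)) (n - k - 3) G)
  /\ ((3 * k) %/ 2 + 3 <= n ->
      forall v : spider (n %/ (k %/ 2 + 1)) (k %/ 2 + 1), leaf v ->
      forall G : graph,
        minimal_tree k n G <->
        Add k (delete_vertex v) (n %% (k %/ 2 + 1)) G).
Proof.
have [s ks] : exists s, k = s.*2 by exists k./2; rewrite even_halfK.
have s_gt0 : 0 < s by lia.
have -> : k %/ 2 + 1 = s.+1 by rewrite ks divn2 doubleK addn1.
have -> : (3 * k) %/ 2 = s * 3 by rewrite ks; lia.
rewrite {}ks in hk2 hk *; split=> [G|].
  rewrite fk_double; have [nk [Gt Gn _]|nk] := leqP n (s.*2 + 1).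
    by rewrite small_num_MDIS // Gn.
  by apply: minimal_num_MDIS => //; lia.
split=> [nk G Gt Gn|].
  by split=> // H Ht Hn; rewrite !small_num_MDIS ?Gn ?Hn.
split=> [nk G|]; first by apply: minimal_path => //; lia.
split=> [nk n3 G|n3 v vl G]; first by apply: minimal_middle => //; lia.
by apply: minimal_large => //; lia.
Qed.
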